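(* Let $g(u,v)=\sum_{i=i_0}^{N}\alpha_iu^i+\sum_{j=j_0}^{M}\beta_jv^j\in\mathcal{O}_K[u,v]$, where $i_0,j_0$ are positive integers with $\gcd(i_0,j_0)=1$, $\alpha_{i_0}\beta_{j_0}\neq 0$, and $\mathrm{ord}(\alpha_i)>\mathrm{ord}(\alpha_{i_0})$ for all $i\ge i_0+1$ and $\mathrm{ord}(\beta_j)>\mathrm{ord}(\beta_{j_0})$ for all $j\ge j_0+1$. Let $\chi$ be a multiplicative character of $\mathcal{O}_K^\times$. Then $Z_g(s,\chi)$ is a rational function of $q^{-s}$; more precisely, there is a polynomial $G(x)\in\mathbb{C}[x]$ such that for all $s\in\mathbb{C}$ with $\mathrm{Re}(s)>0$, $$Z_g(s,\chi)=\frac{G(q^{-s})}{(1-q^{-1-s})(1-q^{-i_0-j_0-i_0j_0s})}.$$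
   Context: $K$ is a non-archimedean local field of characteristic $p>0$, $\mathcal{O}_K$ its ring of integers, $\pi$ a uniformizer, $\mathcal{O}_K^\times$ the unit group, $q$ the cardinality of the residue field $\mathcal{O}_K/\pi\mathcal{O}_K$. For $x\in K^\times$, $\mathrm{ord}(x)$ is the valuation normalized by $\mathrm{ord}(\pi)=1$ ($\mathrm{ord}(0)=\infty$), $x=ac(x)\pi^{\mathrm{ord}(x)}$ with angular component $ac(x)\in\mathcal{O}_K^\times$, and $|x|=q^{-\mathrm{ord}(x)}$. $|dx|$ is the Haar measure on $K^n$ normalized so that $\mathcal{O}_K^n$ has measure $1$. For a character $\chi:\mathcal{O}_K^\times\to\mathbb{C}^\times$ one sets $\chi(ac(0)):=0$. For $f\in\mathcal{O}_K[x_1,\dots,x_n]$ non-constant and $\mathrm{Re}(s)>0$, the Igusa local zeta function is $Z_f(s,\chi)=\int_{\mathcal{O}_K^n}\chi(ac\, f(x))|f(x)|^s|dx|$. *)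

(* Defs.v *)
From HB Require Import structures.
From mathcomp Require Import all_boot all_order all_algebra.
From mathcomp Require Import finmap.
From mathcomp Require Import all_classical all_reals all_analysis.
From mathcomp.real_closed Require Import complex.
From mathcomp.multinomials Require Import(canonicals) mpoly.

Set Implicit Arguments.
Unset Strict Implicit.
Unset Printing Implicit Defensive.

Import Order.TTheory GRing.Theory Num.Theory.
Import numFieldNormedType.Exports.

Local Open Scope classical_set_scope.
Local Open Scope ring_scope.
Local Open Scope complex_scope.

(* Non-archimedean local fields: fields complete for a discrete valuation
   [ord], normalized to have value group Z, with finite residue field. The
   residue field is the set of cosets of the maximal ideal, which is
   pi O_K for any uniformizer pi. *)
HB.mixin Record isLocalField K & GRing.Field K & Uniform K := {
  ord : K -> \bar int;
  ord_zero : ord 0 = +oo%E;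
  ord_fin_num : forall x : K, x != 0 -> ord x \is a fin_num;
  ordM : forall x y : K, ord (x * y) = (ord x + ord y)%E;
  ordD : forall x y : K, (Order.min (ord x) (ord y) <= ord (x + y)%R)%E;
  ord_uniformizer : exists x : K, ord x = 1%:E;
  entourage_ord : forall E : set (K * K), entourage E <->
    exists m : int, [set xy | (m%:E <= ord (xy.1 - xy.2)%R)%E] `<=` E;
  ord_complete : forall F : set_system K,
    ProperFilter F -> cauchy F -> exists l : K, F --> l;
  finite_residue : finite_set
    [set [set x + z | z in [set z : K | (0 < ord z)%E]]
    | x in [set x : K | (0 <= ord x)%E]]
}.

#[short(type="localFieldType")]
HB.structure Definition LocalField :=
  {K of GRing.Field K & Uniform K & isLocalField K}.

#[non_forgetful_inheritance]
HB.instance Definition _ (K : localFieldType) := isPointed.Build K 0.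

Section LocalFieldDefs.
Variable K : localFieldType.

Definition integers : set K := [set x | (0 <= ord x)%E].

Definition maxideal : set K := [set x | (0 < ord x)%E].

Definition unit_integers : set K := [set x | ord x = 0%E].

Definition residue_field : set (set K) :=
  [set [set x + z | z in maxideal] | x in integers].

Definition residue_card : nat := #|` fset_set residue_field|%fset.

Definition is_uniformizer (pi : K) : Prop := ord pi = 1%:E.

(* Only meaningful for [x != 0]. *)
Definition ac (pi x : K) : K := x * pi ^ (- fine (ord x)).

Definition absK (R : realType) (x : K) : R :=
  if x == 0 then 0 else residue_card%:R ^ (- fine (ord x)).

Definition integers_pow (n : nat) : set 'rV[K]_n :=
  [set x | forall i, integers (x ord0 i)].

End LocalFieldDefs.

Notation borel K n := (g_sigma_algebraType (@open 'rV[K]_n)).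

(* On K^n, which is locally compact and second countable, a translation
   invariant Borel measure giving O_K^n measure 1 is finite on compact sets
   and regular, so no further Haar condition is needed. *)
Definition is_normalized_haar (R : realType) (K : localFieldType) (n : nat)
    (mu : {measure set (borel K n) -> \bar R}) : Prop :=
  (forall (x : 'rV[K]_n) (A : set (borel K n)), measurable A ->
    mu [set x + y | y in (A : set 'rV[K]_n)] = mu A) /\
  mu (@integers_pow K n) = 1%E.

(* Continuous homomorphisms from the group of units of O_K to the group of
   nonzero complex numbers; the values of [chi] off the units are irrelevant.
   [R[i]^o] carries the usual topology of the complex numbers. *)
Definition is_character (R : realType) (K : localFieldType)
    (chi : K -> R[i]) : Prop :=
  [/\ forall x, unit_integers x -> chi x != 0,
      forall x y, unit_integers x -> unit_integers y ->
        chi (x * y) = chi x * chi y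
    & {within @unit_integers K, continuous (chi : K -> R[i]^o)}].

Definition chi_ac (R : realType) (K : localFieldType) (chi : K -> R[i])
    (pi x : K) : R[i] :=
  if x == 0 then 0 else chi (ac pi x).

(* [a ^ s = exp (s * ln a)] for [a > 0]. *)
Definition cpow (R : realType) (a : R) (s : R[i]) : R[i] :=
  (expR (complex.Re s * ln a) * cos (complex.Im s * ln a)) +i*
  (expR (complex.Re s * ln a) * sin (complex.Im s * ln a)).

Definition Cintegral (d : measure_display) (T : measurableType d)
    (R : realType) (mu : {measure set T -> \bar R}) (D : set T)
    (f : T -> R[i]) : R[i] :=
  (\int[mu]_(x in D) complex.Re (f x)) +i*
  (\int[mu]_(x in D) complex.Im (f x)).

(* Where [f] vanishes the integrand is 0, because of the factor [chi_ac]. *)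
Definition igusa_zeta (R : realType) (K : localFieldType) (pi : K) (n : nat)
    (mu : {measure set (borel K n) -> \bar R}) (chi : K -> R[i])
    (f : mpoly.mpoly n K) (s : R[i]) : R[i] :=
  Cintegral mu (@integers_pow K n) (fun x : 'rV[K]_n =>
    let fx := mpoly.meval (x ord0) f in
    chi_ac chi pi fx * cpow (absK R fx) s).

Definition separated_poly (K : localFieldType) (i0 N j0 M : nat)
    (alpha beta : nat -> K) : mpoly.mpoly 2 K :=
  let u := mpoly.mpolyX K (mpoly.mnm1 (0 : 'I_2)) in
  let v := mpoly.mpolyX K (mpoly.mnm1 (1 : 'I_2)) in
  \sum_(i0 <= i < N.+1) alpha i *: u ^+ i +
  \sum_(j0 <= j < M.+1) beta j *: v ^+ j.

(* Main.v *)
Require Import Defs.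
From HB Require Import structures.
From mathcomp Require Import all_boot all_order all_algebra.
From mathcomp Require Import finmap.
From mathcomp Require Import all_classical all_reals all_analysis.
From mathcomp.real_closed Require Import complex.
From mathcomp.multinomials Require Import(canonicals) mpoly.
From mathcomp Require Import measurable_realfun.
From mathcomp Require Import zify ring lra.

Set Implicit Arguments.
Unset Strict Implicit.
Unset Printing Implicit Defensive.

Import Order.TTheory GRing.Theory Num.Theory.
Import numFieldNormedType.Exports.

Local Open Scope classical_set_scope.
Local Open Scope ring_scope.
Local Open Scope complex_scope.

(** Write [g(u,v) = A(u) + B(v)] and [D = i0 j0].  Since [g] is Lipschitz and
    [chi] factors through a finite quotient of the units, the coefficient of
    [q^(-ns)] in [Z_g(s,chi)] is the mean over [O_K^2] of a locally constant
    function, [chi (ac g)] on [ord g = n]; such means are finite averages over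
    residues.  The substitution [(u,v) -> (pi^j0 u, pi^i0 v)] divides measures
    by [q^(i0+j0)] and turns [g] into [pi^D g_1], where [g_1] is of the same
    shape with closer-to-0 higher terms; iterating it gives [g_k], and splits
    the coefficients of [g_k] into a part over the fundamental domain
    [{ord u < j0} U {ord v < i0}] plus [q^-(i0+j0)] times the coefficients of
    [g_(k+1)] shifted by [D].  Because [i0] and [j0] are coprime, one of them,
    say [j0], is prime to the characteristic; on the part of the domain where
    [ord g] is large, [ord v] is bounded and [v |-> g_k(u,v)] is, up to scaling,
    an isometry on small discs, so from some [n] on (uniformly in [k]) the
    domain coefficients are multiplied by [q^-1] when [n] grows by 1.  For
    large [k] they do not depend on [k], as [g_k] converges.  Hence the
    coefficients of [Z_g] are eventually annihilated by
    [(1 - q^-1 S) (1 - q^-(i0+j0) S^D)], with [S] the shift. *)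

(** * The valuation as an integer, and the fractional ideals *)

Section Valuation.
Variable K : localFieldType.
Implicit Types (x y z : K) (n m : int).

(* [valz 0 = 0] is a junk value. *)
Definition valz x : int := fine (ord x).

(* Membership in the fractional ideal pi^n O_K. *)
Definition dv n x : bool := (x == 0) || (n <= valz x).

Lemma ordE x : x != 0 -> ord x = (valz x)%:E.
Proof. by move=> x0; rewrite /valz fineK// ord_fin_num. Qed.

Lemma dvE n x : dv n x = (n%:E <= ord x)%E.
Proof.
rewrite /dv; case: eqVneq => [->|x0]/=; first by rewrite ord_zero leey.
by rewrite ordE// lee_fin.
Qed.

Lemma dvN0 n x : x != 0 -> dv n x = (n <= valz x).
Proof. by rewrite /dv => /negbTE->. Qed.

Lemma dv_0 n : dv n (0 : K).
Proof. by rewrite /dv eqxx. Qed.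

Lemma valzM x y : x != 0 -> y != 0 -> valz (x * y) = valz x + valz y.
Proof.
move=> x0 y0; have xy0 : x * y != 0 by rewrite mulf_neq0.
have /eqP := ordM x y.
by rewrite !ordE// -EFinD eqe => /eqP.
Qed.

Lemma valz1 : valz (1 : K) = 0.
Proof.
have := @valzM 1 1 (oner_neq0 K) (oner_neq0 K); rewrite mulr1; lia.
Qed.

Lemma valzV x : x != 0 -> valz x^-1 = - valz x.
Proof.
move=> x0; have := @valzM x x^-1 x0; rewrite invr_eq0 mulfV// valz1.
by move=> /(_ x0); lia.
Qed.

Lemma valzN x : valz (- x) = valz x.
Proof.
have N1 : valz (-1 : K) = 0.
  have N10 : -1 != 0 :> K by rewrite oppr_eq0 oner_eq0.
  have := @valzM (-1) (-1) N10 N10; rewrite mulrNN mulr1 valz1; lia.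
have [->|x0] := eqVneq x 0; first by rewrite oppr0.
by rewrite -mulN1r valzM// ?N1 ?add0r// oppr_eq0 oner_eq0.
Qed.

Lemma valzX x (k : nat) : x != 0 -> valz (x ^+ k) = valz x * k.
Proof.
move=> x0; elim: k => [|k IH]; first by rewrite expr0 valz1 mulr0.
by rewrite exprS valzM ?expf_neq0// IH; lia.
Qed.

Lemma dvN n x : dv n (- x) = dv n x.
Proof. by rewrite /dv oppr_eq0 valzN. Qed.

Lemma dvD n x y : dv n x -> dv n y -> dv n (x + y).
Proof.
rewrite !dvE => nx ny; apply: le_trans (ordD x y).
by rewrite le_min nx ny.
Qed.

Lemma dvB n x y : dv n x -> dv n y -> dv n (x - y).
Proof. by move=> nx ny; rewrite dvD// dvN. Qed.

Lemma dvC n x y : dv n (x - y) = dv n (y - x).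
Proof. by rewrite -dvN opprB. Qed.

Lemma dvDr n x y : dv n y -> dv n (x + y) = dv n x.
Proof.
move=> ny; apply/idP/idP => [h|h]; last exact: dvD.
by rewrite -(addrK y x) dvB.
Qed.

Lemma dvW n m x : m <= n -> dv n x -> dv m x.
Proof. by rewrite /dv => mn /orP[->//|nx]; rewrite (le_trans mn nx) orbT. Qed.

Lemma dvM n m x y : dv n x -> dv m y -> dv (n + m) (x * y).
Proof.
have [->|x0] := eqVneq x 0; first by rewrite mul0r !dv_0.
have [->|y0] := eqVneq y 0; first by rewrite mulr0 !dv_0.
rewrite !dvN0 ?mulf_neq0 // valzM //; lia.
Qed.

Lemma dvMr n x y : dv n x -> dv 0 y -> dv n (x * y).
Proof. by move=> nx y0; rewrite -[n]addr0 dvM. Qed.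

Lemma dvMl n x y : dv 0 x -> dv n y -> dv n (x * y).
Proof. by move=> nx y0; rewrite -[n]add0r dvM. Qed.

Lemma dv_val n x y : x != 0 -> dv (n + valz x) (x * y) = dv n y.
Proof.
move=> x0; have [->|y0] := eqVneq y 0; first by rewrite mulr0 !dv_0.
rewrite !dvN0 ?mulf_neq0 // valzM //; lia.
Qed.

Lemma dv1 : dv 0 (1 : K).
Proof. by rewrite dvN0 ?oner_neq0// valz1. Qed.

Lemma dvX x (k : nat) : dv 0 x -> dv 0 (x ^+ k).
Proof.
move=> x0; elim: k => [|k IH]; first by rewrite expr0 dv1.
by rewrite exprS dvMr.
Qed.

Lemma dvXn n x (k : nat) : dv n x -> dv (n * k) (x ^+ k).
Proof.
move=> nx; elim: k => [|k IH]; first by rewrite expr0 mulr0 dv1.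
by rewrite exprS (_ : n * k.+1 = n + n * k) ?dvM//; lia.
Qed.

Lemma dv_nat (k : nat) : dv 0 (k%:R : K).
Proof.
elim: k => [|k IH]; first by rewrite dv_0.
by rewrite -natr1 dvD// dv1.
Qed.

Lemma dv_sum n (I : Type) (s : seq I) (P : pred I) (F : I -> K) :
  (forall i, P i -> dv n (F i)) -> dv n (\sum_(i <- s | P i) F i).
Proof. by move=> h; elim/big_ind: _ => //; [exact: dv_0|move=> *; exact: dvD]. Qed.

(** A sphere is a difference of two balls, so its stability under small translations reduces to that
    of balls. *)
Lemma valzP n x : (x != 0) && (valz x == n) = dv n x && ~~ dv (n + 1) x.
Proof.
rewrite /dv; case: eqVneq => //= _; lia.
Qed.

Lemma valz_perturb n x y : dv (n + 1) y ->
  (x + y != 0) && (valz (x + y) == n) = (x != 0) && (valz x == n).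
Proof.
by move=> ny; rewrite !valzP !dvDr//; apply: dvW ny; lia.
Qed.

Lemma valzD_eq x y : x != 0 -> dv (valz x + 1) y ->
  (x + y != 0) /\ valz (x + y) = valz x.
Proof.
move=> x0 /valz_perturb => /(_ x); rewrite x0 eqxx/= => /andP[-> /eqP].
by [].
Qed.

Lemma integersE x : integers x = dv 0 x.
Proof. by rewrite /integers/= dvE. Qed.

Lemma unit_integersE x : unit_integers x <-> (x != 0) && (valz x == 0).
Proof.
rewrite /unit_integers/=; split.
  have [->|x0] := eqVneq x 0; first by rewrite ord_zero.
  by rewrite ordE// => -[->].
by move=> /andP[x0 /eqP vx]; rewrite ordE// vx.
Qed.

Lemma maxidealE x : maxideal x = dv 1 x.
Proof.
rewrite /maxideal/= /dv; case: eqVneq => [->|x0]; first by rewrite ord_zero ltry.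
by rewrite ordE// lte_fin/= gtz0_ge1.
Qed.

Section NatUnit.
Variables (p : nat) (charK : p \in [pchar K]).

(** Bezout gives [u * k = v * p + 1], so [k] is inverted in $K$ by another natural number; both
    valuations are nonnegative and add up to 0. *)
Lemma valz_natr (k : nat) : ~~ (p %| k)%N -> k%:R != 0 :> K /\ valz k%:R = 0.
Proof.
move=> pk; have pp := pcharf_prime charK.
have k0 : k%:R != 0 :> K by rewrite -(dvdn_pcharf charK).
split=> //.
have kgt0 : (0 < k)%N by case: k pk {k0} => //; rewrite dvdn0.
have cop : coprime k p by rewrite coprime_sym prime_coprime.
have [u v uv _] := egcdnP p kgt0; move: cop => /eqP cop.
have e : (u * k)%:R = 1 :> K.
  rewrite uv cop natrD natrM (_ : p%:R = 0) ?mulr0 ?add0r//.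
  exact: pcharf0.
have u0 : u%:R != 0 :> K.
  by apply: contra_eq_neq e => ux; rewrite natrM ux mul0r eq_sym oner_neq0.
have := valzM u0 k0; rewrite -natrM e valz1.
have := dv_nat u; have := dv_nat k; rewrite !dvN0//; lia.
Qed.
End NatUnit.

End Valuation.

(** * Digits and representatives of $O_K / pi^m$ *)

Section Residues.
Variables (K : localFieldType) (pi : K).
Hypothesis pi_unif : is_uniformizer pi.
Implicit Types (x y z : K).

Lemma pi_neq0 : pi != 0.
Proof.
by apply/eqP => pi0; move: pi_unif; rewrite /is_uniformizer pi0 ord_zero.
Qed.

Lemma valz_pi : valz pi = 1.
Proof. by rewrite /valz pi_unif. Qed.

Lemma valz_piX (k : nat) : valz (pi ^+ k) = k.
Proof. by rewrite valzX ?pi_neq0// valz_pi mul1r. Qed.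

Lemma piX_neq0 (k : nat) : pi ^+ k != 0.
Proof. by rewrite expf_neq0// pi_neq0. Qed.

Lemma dv_piX (n : int) (k : nat) x : dv (n + k) (pi ^+ k * x) = dv n x.
Proof. by rewrite -{1}(valz_piX k) dv_val ?piX_neq0. Qed.

Lemma dv_pi (n : int) x : dv (n + 1) (pi * x) = dv n x.
Proof. exact: (dv_piX n 1). Qed.

Lemma dv_piXW (k : nat) x : dv 0 x -> dv k (pi ^+ k * x).
Proof. by move=> x0; rewrite -[k : int]add0r dv_piX. Qed.

Lemma dv_piX0 (k : nat) : dv 0 (pi ^+ k).
Proof. by rewrite dvN0 ?piX_neq0// valz_piX. Qed.

Lemma dv_factor (k : nat) x : dv k x -> exists2 y, dv 0 y & x = pi ^+ k * y.
Proof.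
move=> kx; exists (x / pi ^+ k); last by rewrite mulrC divfK ?piX_neq0.
by rewrite -(dv_piX 0 k) mulrC divfK ?piX_neq0// add0r.
Qed.

Local Notation q := (residue_card K).

Lemma residue_finite : finite_set (@residue_field K).
Proof. exact: finite_residue. Qed.

(** The maximal ideal is represented by 0, so that 0 is a digit and belongs to every [reps m]. *)
Definition coset_repr (C : set K) : K := if `[< C 0 >] then 0 else xget 0 C.

Definition digits : seq K := [seq coset_repr C | C <- fset_set (@residue_field K)].

Lemma size_digits : size digits = q.
Proof. by rewrite size_map /residue_card. Qed.

Lemma coset_reprP C x : residue_field C -> C x <-> dv 1 (x - coset_repr C).
Proof.
move=> [y _ <-].
have main w : [set y + z | z in @maxideal K] w -> 
    [set y + z | z in @maxideal K] x <-> dv 1 (x - w).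
  move=> [z]; rewrite maxidealE => z1 <-; split=> [[z']|h].
    rewrite maxidealE => z1' <-.
    by rewrite (_ : y + z' - (y + z) = z' - z); [exact: dvB|ring].
  exists (x - y); last by rewrite addrC subrK.
  by rewrite maxidealE (_ : x - y = x - (y + z) + z); [exact: dvD|ring].
apply: main; rewrite /coset_repr; case: asboolP => // _.
by apply: xgetPex; exists y; exists 0; rewrite ?addr0// maxidealE dv_0.
Qed.

Lemma digits_dv x : x \in digits -> dv 0 x.
Proof.
move=> /mapP[C]; rewrite in_fset_set ?inE; last exact: residue_finite.
move=> CF ->; have [y yO yC] := CF.
have : C y by rewrite -yC; exists 0; rewrite ?addr0// maxidealE dv_0.
move=> /(coset_reprP _ CF) /(@dvW _ 1 0 _ isT) yr.
rewrite -(subKr y (coset_repr C)) dvB//.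
by have : integers y by []; rewrite integersE.
Qed.

Lemma digits_ex x : dv 0 x -> exists2 a, a \in digits & dv 1 (x - a).
Proof.
move=> x0; pose C := [set x + z | z in @maxideal K].
have CF : residue_field C by exists x => //; rewrite integersE.
exists (coset_repr C).
  by apply/map_f; rewrite in_fset_set ?inE//; exact: residue_finite.
by apply/(coset_reprP _ CF); exists 0; rewrite ?addr0// maxidealE dv_0.
Qed.

Lemma coset_repr_inj C D : residue_field C -> residue_field D ->
  dv 1 (coset_repr C - coset_repr D) -> C = D.
Proof.
move=> CF DF h; apply/seteqP; split=> x.
  move=> /(coset_reprP _ CF) xC; apply/(coset_reprP _ DF).
  by rewrite -(subrK (coset_repr C) x) -addrA dvD.
move=> /(coset_reprP _ DF) xC; apply/(coset_reprP _ CF).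
by rewrite -(subrK (coset_repr D) x) -addrA dvD// dvC.
Qed.

Lemma digits_sep a b : a \in digits -> b \in digits -> dv 1 (a - b) -> a = b.
Proof.
move=> /mapP[C CF ->] /mapP[D DF ->]; move: CF DF.
rewrite !in_fset_set ?inE; [|exact: residue_finite..].
by move=> CF DF /coset_repr_inj ->.
Qed.

Lemma digits_uniq : uniq digits.
Proof.
rewrite map_inj_in_uniq ?fset_uniq// => C D.
rewrite !in_fset_set ?inE; [|exact: residue_finite..].
by move=> CF DF e; apply: coset_repr_inj => //; rewrite e subrr dv_0.
Qed.

Lemma digits0 : 0 \in digits.
Proof.
have CF : residue_field (@maxideal K).
  exists 0; first by rewrite /= integersE dv_0.
  by apply/seteqP; split=> x /= => [[z ? <-]|?]; [rewrite add0r|exists x; rewrite ?add0r].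
have <- : coset_repr (@maxideal K) = 0.
  by rewrite /coset_repr asboolT// maxidealE dv_0.
by apply/map_f; rewrite in_fset_set ?inE//; exact: residue_finite.
Qed.

Lemma q_gt1 : (1 < q)%N.
Proof.
have [a aD a1] := digits_ex (dv1 K).
have a0 : a != 0.
  apply: contraL a1 => /eqP ->; rewrite subr0 dvN0 ?oner_neq0//.
  by rewrite valz1.
rewrite -size_digits; apply: (@uniq_leq_size _ [:: 0; a]).
  by rewrite /= inE eq_sym a0.
by move=> x; rewrite !inE => /orP[] /eqP ->//; exact: digits0.
Qed.

Lemma q_gt0 : (0 < q)%N. Proof. exact: ltnW q_gt1. Qed.

(** Truncated pi-adic expansions with [m] digits: a system of representatives of $O_K / pi^m$. *)
Fixpoint reps (m : nat) : seq K :=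
  if m is m'.+1 then [seq a + pi * b | a <- digits, b <- reps m'] else [:: 0].

Lemma reps_dv m x : x \in reps m -> dv 0 x.
Proof.
elim: m x => [|m IH] x /=; first by rewrite inE => /eqP ->; rewrite dv_0.
move=> /allpairsP[[a b]/= [/digits_dv a0 /IH b0 ->]].
by rewrite dvD// dvMr// (dv_piX0 1).
Qed.

Lemma size_reps m : size (reps m) = (q ^ m)%N.
Proof.
by elim: m => //= m IH; rewrite size_allpairs IH size_digits expnS.
Qed.

Lemma reps_sep m a b : a \in reps m -> b \in reps m -> dv m (a - b) -> a = b.
Proof.
elim: m a b => [|m IH] a b /=; first by rewrite !inE => /eqP -> /eqP ->.
move=> /allpairsP[[a1 a2]/= [a1D a2R ->]] /allpairsP[[b1 b2]/= [b1D b2R ->]] h.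
have e1 : a1 = b1.
  apply: digits_sep => //.
  rewrite (_ : a1 - b1 = a1 + pi * a2 - (b1 + pi * b2) - pi * (a2 - b2)); last by ring.
  apply: dvB; first by apply: dvW h; lia.
  by rewrite -[1]add0r dv_pi dvB// (@reps_dv m).
move: h; rewrite e1 (_ : _ - _ = pi * (a2 - b2)); last by ring.
by rewrite (_ : Posz m.+1 = (Posz m) + 1) ?dv_pi; [move=> /IH ->|lia].
Qed.

Lemma reps_uniq m : uniq (reps m).
Proof.
elim: m => //= m IH; apply: allpairs_uniq => //; first exact: digits_uniq.
move=> _ _ /allpairsP[[a1 a2]/= [a1D a2R ->]] /allpairsP[[b1 b2]/= [b1D b2R ->]] /= e.
have e1 : a1 = b1.
  apply: digits_sep => //.
  have -> : a1 - b1 = (a1 + pi * a2) - (b1 + pi * b2) - pi * (a2 - b2) by ring.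
  rewrite e subrr sub0r dvN -[1]add0r dv_pi dvB// (@reps_dv m)//.
by move: e; rewrite e1 => /addrI/(mulfI pi_neq0) ->.
Qed.

Lemma reps_ex m x : dv 0 x -> exists2 a, a \in reps m & dv m (x - a).
Proof.
elim: m x => [|m IH] x x0; first by exists 0; rewrite ?inE// subr0.
have [a aD] := digits_ex x0; move=> /(dv_factor (k := 1))[y y0].
rewrite expr1 => xa; have [b bR yb] := IH _ y0.
exists (a + pi * b); first by apply/allpairsP; exists (a, b).
rewrite opprD addrA xa -mulrBr (_ : Posz m.+1 = (Posz m) + 1) ?dv_pi//; lia.
Qed.

Lemma reps0 m : 0 \in reps m.
Proof.
elim: m => [|m IH]; first by rewrite inE.
by apply/allpairsP; exists (0, 0); rewrite digits0 IH /= mulr0 addr0.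
Qed.

Lemma big_reps_split (F : nmodType) (f : K -> F) L m :
  \sum_(x <- reps (L + m)) f x =
  \sum_(a <- reps L) \sum_(x <- reps m) f (a + pi ^+ L * x).
Proof.
elim: L f => [|L IH] f.
  by rewrite big_seq1; apply: eq_bigr => x _; rewrite add0r mul1r.
rewrite addSn /= !big_allpairs_dep; apply: eq_bigr => a _.
rewrite IH; apply: eq_bigr => b _; apply: eq_bigr => x _.
by congr f; rewrite exprS; ring.
Qed.

Definition isometry (H : K -> K) : Prop :=
  (forall x, dv 0 x -> dv 0 (H x)) /\
  (forall (n : nat) x y, dv 0 x -> dv 0 y -> dv n (H x - H y) = dv n (x - y)).

(** * Means of locally constant functions as finite averages over residues *)

Section Mean.
Variable F : numFieldType.
Implicit Type f : K -> F.

Definition per (M : nat) f : Prop :=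
  forall x z, dv 0 x -> dv M z -> f (x + z) = f x.

Lemma perP M f x y : per M f -> dv 0 x -> dv M (x - y) -> f x = f y.
Proof. by move=> fM x0 h; rewrite -{1}(subKr x y) fM ?dvN. Qed.

Lemma perW M m f : (M <= m)%N -> per M f -> per m f.
Proof. by move=> Mm fM x z x0 z0; rewrite fM//; apply: dvW z0; lia. Qed.

Definition avg m f : F := (\sum_(x <- reps m) f x) / (q ^ m)%:R.

Lemma qX_neq0 m : (q ^ m)%:R != 0 :> F.
Proof. by rewrite pnatr_eq0 -lt0n expn_gt0 q_gt0. Qed.

(* The normalized integral of [f] over O_K when [f] is locally constant; the
   precision [M] is irrelevant by [meanE]. *)
Definition mean f : F := avg (xget 0%N [set M | per M f]) f.

Lemma avg_split L m f :
  avg (L + m) f = (\sum_(a <- reps L) avg m (fun x => f (a + pi ^+ L * x))) / (q ^ L)%:R.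
Proof.
rewrite /avg big_reps_split -big_distrl/= -mulrA; congr (_ * _).
by rewrite expnD natrM invfM mulrC.
Qed.

Lemma avg_cst m c : avg m (fun=> c) = c.
Proof.
by rewrite /avg big_const_seq count_predT size_reps iter_addr_0 -[c *+ _]mulr_natr mulfK ?qX_neq0.
Qed.

Lemma eq_avg m f g : (forall x, dv 0 x -> f x = g x) -> avg m f = avg m g.
Proof.
move=> fg; rewrite /avg; congr (_ / _); apply: eq_big_seq => x /reps_dv; exact: fg.
Qed.

(** The digits beyond the first [M] do not affect [f], so averaging over them changes nothing. *)
Lemma avg_per M m f : per M f -> (M <= m)%N -> avg m f = avg M f.
Proof.
move=> fM Mm; rewrite -(subnKC Mm) avg_split; congr (_ / _).
apply: eq_big_seq => a /reps_dv a0; rewrite -[RHS](avg_cst (m - M)).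
by apply: eq_avg => x x0; rewrite fM// dv_piXW.
Qed.

Lemma meanE M m f : per M f -> (M <= m)%N -> mean f = avg m f.
Proof.
move=> fM Mm; rewrite /mean; set M' := xget _ _.
have fM' : per M' f by apply: (@xgetPex _ _ [set M | per M f]); exists M.
by rewrite -(avg_per fM' (leq_maxl M' m)) -(avg_per (perW Mm fM) (leq_maxr M' m)).
Qed.

Lemma per_ext M f g : (forall x, dv 0 x -> f x = g x) -> per M f -> per M g.
Proof.
move=> fg fM x z x0 z0; have xz0 : dv 0 (x + z) by rewrite dvD//; apply: dvW z0.
by rewrite -!fg// fM.
Qed.

Lemma eq_mean M f g : per M f -> (forall x, dv 0 x -> f x = g x) -> mean f = mean g.
Proof.
move=> fM fg; rewrite (meanE fM (leqnn M)) (meanE (per_ext fg fM) (leqnn M)).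
exact: eq_avg.
Qed.

(** An isometry induces an injection of the finite set $O_K / pi^M$ into itself, hence a permutation
    of the terms of the average. *)
Lemma mean_iso M f H : per M f -> isometry H -> mean (fun x => f (H x)) = mean f.
Proof.
move=> fM [H0 HM].
have fHM : per M (fun x => f (H x)).
  move=> x z x0 z0; have xz0 : dv 0 (x + z) by rewrite dvD//; apply: dvW z0.
  by apply: (perP fM); rewrite ?H0// HM// addrC addKr.
rewrite (meanE fM (leqnn M)) (meanE fHM (leqnn M)) /avg; congr (_ / _).
pose red x := xget 0 [set a | a \in reps M /\ dv M (x - a)].
have redP x : dv 0 x -> red x \in reps M /\ dv M (x - red x).
  move=> /(reps_ex M)[a aR xa].
  by apply: (@xgetPex _ 0 [set a | a \in reps M /\ dv M (x - a)]); exists a.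
transitivity (\sum_(y <- [seq red (H x) | x <- reps M]) f y).
  rewrite big_map; apply: eq_big_seq => x /reps_dv x0.
  by apply: (perP fM); [exact: H0|exact: (redP _ (H0 _ x0)).2].
apply: perm_big.
have u : uniq [seq red (H x) | x <- reps M].
  rewrite map_inj_in_uniq ?reps_uniq// => x y xR yR e.
  have [x0 y0] := (reps_dv xR, reps_dv yR).
  apply: (reps_sep xR yR); rewrite -HM//.
  have [_ h1] := redP _ (H0 _ x0); have [_ h2] := redP _ (H0 _ y0).
  by rewrite -(subrK (red (H x)) (H x)) -addrA dvD// e dvC.
have s : {subset [seq red (H x) | x <- reps M] <= reps M}.
  by move=> _ /mapP[x xR ->]; apply: (redP _ _).1; rewrite H0// (@reps_dv M).
apply: uniq_perm => //; first exact: reps_uniq.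
(* Injectivity and equal sizes force surjectivity onto [reps M]. *)
by have [] := uniq_min_size u s; rewrite ?size_map.
Qed.

Lemma per_sub M f L a : dv 0 a -> per M f -> per M (fun x => f (a + pi ^+ L * x)).
Proof.
move=> a0 fM x z x0 z0; rewrite mulrDr addrA; apply: fM.
  by rewrite dvD// dvMr// dv_piX0.
by rewrite dvMl// dv_piX0.
Qed.

(** $O_K$ is the disjoint union of the $q^L$ discs $a + pi^L O_K$, each of measure $q^(-L)$. *)
Lemma mean_split M f L : per M f -> mean f =
  (\sum_(a <- reps L) mean (fun x => f (a + pi ^+ L * x))) / (q ^ L)%:R.
Proof.
move=> fM; rewrite (@meanE M (L + M))// ?leq_addl// avg_split; congr (_ / _).
apply: eq_big_seq => a /reps_dv a0.
by rewrite (@meanE M M)//; exact: per_sub.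
Qed.

Lemma meanZ M f c : per M f -> mean (fun x => c * f x) = c * mean f.
Proof.
move=> fM; have cfM : per M (fun x => c * f x) by move=> x z x0 z0; rewrite fM.
by rewrite (meanE fM (leqnn M)) (meanE cfM (leqnn M)) /avg -mulr_sumr mulrA.
Qed.

Lemma meanD M f g : per M f -> per M g -> mean (fun x => f x + g x) = mean f + mean g.
Proof.
move=> fM gM; have fgM : per M (fun x => f x + g x) by move=> x z x0 z0; rewrite fM// gM.
by rewrite (meanE fM (leqnn M)) (meanE gM (leqnn M)) (meanE fgM (leqnn M)) /avg big_split mulrDl.
Qed.

Lemma mean_cst c : mean (fun=> c) = c.
Proof. by rewrite (@meanE 0 0) ?avg_cst. Qed.

Lemma mean0 f : (forall x, dv 0 x -> f x = 0) -> mean f = 0.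
Proof.
move=> f0; rewrite -[RHS](mean_cst 0); apply: esym; apply: (@eq_mean 0) => //.
by move=> x /f0.
Qed.

Lemma mean_dv M f (L : nat) : per M f ->
  mean (fun x => if dv L x then f x else 0) = mean (fun x => f (pi ^+ L * x)) / (q ^ L)%:R.
Proof.
move=> fM; have fM' : per (maxn M L) (fun x => if dv L x then f x else 0).
  move=> x z x0 z0; rewrite dvDr; last by apply: dvW z0; lia.
  by case: ifP => // _; rewrite fM//; apply: dvW z0; lia.
(* Among the discs of radius $q^(-L)$ only the one around 0 meets the support. *)
rewrite (mean_split L fM'); congr (_ / _).
rewrite (bigD1_seq 0) ?reps0 ?reps_uniq//= big1_seq ?addr0 => [|a /andP[a0 aR]].
  apply: esym; apply: (@eq_mean M).
    apply: (per_ext (f := fun x => f (0 + pi ^+ L * x))).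
      by move=> x _; rewrite add0r.
    by apply: per_sub => //; exact: dv_0.
  by move=> x x0; rewrite add0r dv_piXW.
apply: mean0 => x x0; rewrite dvDr ?dv_piXW//; case: ifP => // h.
by case/negP: a0; apply/eqP; apply: (reps_sep aR (reps0 L)); rewrite subr0.
Qed.

Definition per2 (M : nat) (f : K -> K -> F) : Prop := forall x y z t,
  dv 0 x -> dv 0 y -> dv M z -> dv M t -> f (x + z) (y + t) = f x y.

Definition mean2 (f : K -> K -> F) : F := mean (fun x => mean (f x)).

Lemma per2r M (f : K -> K -> F) x : per2 M f -> dv 0 x -> per M (f x).
Proof.
by move=> fM x0 y z y0 z0; have := fM x y 0 z x0 y0 (dv_0 _ _) z0; rewrite addr0.
Qed.

Lemma per2l M (f : K -> K -> F) : per2 M f -> per M (fun x => mean (f x)).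
Proof.
move=> fM x z x0 z0.
have xz0 : dv 0 (x + z) by rewrite dvD//; apply: dvW z0.
apply: (eq_mean (per2r fM xz0)) => y y0.
by have := fM x y z 0 x0 y0 z0 (dv_0 _ _); rewrite addr0.
Qed.

Lemma mean2E M m (f : K -> K -> F) : per2 M f -> (M <= m)%N -> mean2 f = avg m (fun x => avg m (f x)).
Proof.
move=> fM Mm; rewrite /mean2 (meanE (per2l fM) Mm); apply: eq_avg => x x0.
by rewrite (meanE (per2r fM x0) Mm).
Qed.

(** Fubini, which at a common finite precision is the exchange of two finite sums. *)
Lemma mean2_swap M (f : K -> K -> F) : per2 M f -> mean2 f = mean2 (fun x y => f y x).
Proof.
move=> fM; have fM' : per2 M (fun x y => f y x) by move=> *; exact: fM.
rewrite (mean2E fM (leqnn M)) (mean2E fM' (leqnn M)) /avg.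
by rewrite -!big_distrl/= exchange_big.
Qed.

Lemma eq_mean2 M (f g : K -> K -> F) : per2 M f -> (forall x y, dv 0 x -> dv 0 y -> f x y = g x y) ->
  mean2 f = mean2 g.
Proof.
move=> fM fg; apply: (eq_mean (per2l fM)) => x x0.
by apply: (eq_mean (per2r fM x0)) => y; exact: fg.
Qed.

Lemma mean2D M (f g : K -> K -> F) : per2 M f -> per2 M g ->
  mean2 (fun x y => f x y + g x y) = mean2 f + mean2 g.
Proof.
move=> fM gM; rewrite -(meanD (per2l fM) (per2l gM)).
apply: (@eq_mean M).
  apply: (per2l (f := fun x y => f x y + g x y)) => x y z t x0 y0 z0 t0.
  by rewrite fM// gM.
by move=> x x0; rewrite (meanD (per2r fM x0) (per2r gM x0)).
Qed.

Lemma mean2Z M (f : K -> K -> F) c : per2 M f -> mean2 (fun x y => c * f x y) = c * mean2 f.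
Proof.
move=> fM; rewrite -(meanZ c (per2l fM)); apply: (@eq_mean M).
  by apply: (per2l (f := fun x y => c * f x y)) => x y z t x0 y0 z0 t0; rewrite fM.
by move=> x x0; rewrite (meanZ c (per2r fM x0)).
Qed.

End Mean.
End Residues.

(** * One-variable summands of $g$: size, variation and rescaling *)

Section DiagonalSum.
Variables (K : localFieldType) (pi : K).
Hypothesis pi_unif : is_uniformizer pi.
Implicit Types (u v w x y z : K).

Definition psum (i0 N : nat) (alpha : nat -> K) u : K :=
  \sum_(i0 <= i < N.+1) alpha i * u ^+ i.

(** The hypotheses on one half of $g$, with [e] the valuation of the lowest coefficient; they make
    the lowest term dominate on all of $O_K$. *)
Definition admissible (e i0 N : nat) (alpha : nat -> K) : Prop :=
  [/\ (0 < i0 <= N)%N, alpha i0 != 0, valz (alpha i0) = e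
    & forall i, (i0 < i <= N)%N -> dv (e%:Z + 1) (alpha i)].

(* The coefficients of [pi ^- (D * i0) * psum i0 N alpha (pi ^+ D * u)]. *)
Definition rescale (D i0 : nat) (alpha : nat -> K) (i : nat) : K :=
  alpha i * pi ^+ (D * (i - i0)).

Section Psum.
Variables (e i0 N : nat) (alpha : nat -> K).
Hypothesis adm : admissible e i0 N alpha.
Local Notation A := (psum i0 N alpha).

Lemma psum_recl u : A u = alpha i0 * u ^+ i0 + \sum_(i0.+1 <= i < N.+1) alpha i * u ^+ i.
Proof. by have [/andP[_ h] _ _ _] := adm; rewrite /psum big_ltn. Qed.

Lemma adm_dv i : (i0 <= i <= N)%N -> dv e (alpha i).
Proof.
have [_ a0 va h] := adm; rewrite leq_eqVlt andb_orl => /orP[/andP[/eqP <- _]|/h].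
  by rewrite dvN0// va.
by apply: dvW; lia.
Qed.

(** The factorization of $x^i - y^i$ shows that each monomial with integral coefficient is
    1-Lipschitz on $O_K$. *)
Lemma psum_lip (n : nat) u z : dv 0 u -> dv n z -> dv n (A (u + z) - A u).
Proof.
move=> u0 zn; have z0 : dv 0 z by apply: dvW zn.
rewrite /psum -sumrB big_nat_cond; apply: dv_sum => i; rewrite andbT => /adm_dv ai.
rewrite -mulrBr subrXX addrAC subrr add0r mulrCA dvMr// dvMl//.
  by apply: dvW ai.
by apply: dv_sum => j _; rewrite dvMr// dvX// dvD.
Qed.

Lemma psum_dv (n : nat) u : dv n u -> dv (e + i0 * n)%N (A u).
Proof.
move=> nu; have u0 : dv 0 u by apply: dvW nu.
rewrite /psum big_nat_cond; apply: dv_sum => i; rewrite andbT => hi.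
rewrite PoszD dvM ?adm_dv//.
rewrite (_ : i = i0 + (i - i0))%N; last by rewrite subnKC//; case/andP: hi.
rewrite exprD dvMr ?dvX//.
by rewrite mulnC PoszM dvXn.
Qed.

Lemma psum_int u : dv 0 u -> dv 0 (A u).
Proof. by move=> /(psum_dv (n := 0)); apply: dvW. Qed.

(** Each higher term has at least as large a power of [u] and a coefficient of strictly larger
    valuation, so the lowest term decides. *)
Lemma psum_val u (b : nat) : u != 0 -> valz u = b ->
  A u != 0 /\ valz (A u) = (e + i0 * b)%N.
Proof.
move=> u0 ub; have [/andP[i0_gt0 _] a0 va h] := adm.
have m0 : alpha i0 * u ^+ i0 != 0 by rewrite mulf_neq0 ?expf_neq0.
have mv : valz (alpha i0 * u ^+ i0) = (e + i0 * b)%N.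
  by rewrite valzM ?expf_neq0// va valzX// ub; lia.
have ub' : dv b u by rewrite dvN0// ub.
have u00 : dv 0 u by apply: dvW ub'.
rewrite psum_recl -mv; apply: valzD_eq => //; rewrite mv.
rewrite big_nat_cond; apply: dv_sum => i; rewrite andbT => hi.
rewrite (_ : (e + i0 * b)%N%:Z + 1 = (e%:Z + 1) + (b * i0)%N); last by lia.
rewrite dvM ?h//.
rewrite (_ : i = i0 + (i - i0))%N; last by rewrite subnKC//; case/andP: hi => /ltnW.
by rewrite exprD dvMr ?dvX// PoszM dvXn.
Qed.

(* The error term of (1 + y)^k = 1 + k y + O(y^2). *)
Lemma expr1D_sub1 y k : dv 0 y ->
  exists2 t, dv 0 t & (1 + y) ^+ k - 1 = y * (k%:R + y * t).
Proof.
move=> y0; elim: k => [|k [t t0 IH]].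
  by exists 0; rewrite ?dv_0// expr0 mulr0 addr0 subrr mulr0.
exists (t + k%:R + y * t); first by rewrite !dvD ?dv_nat// dvMr.
rewrite exprS -natr1.
have -> : (1 + y) ^+ k = 1 + y * (k%:R + y * t) by rewrite -IH; ring.
ring.
Qed.

(** Near [v] the map [A] scales distances by the size of its derivative, of valuation
    [e + i0.-1 * b]. With [v' = v * (1 + y)], the quotient of [A v' - A v] by [y] is a sum whose
    term of index [i0] dominates, because [i0] is a unit. *)
Lemma psum_dilation v v' (b : nat) (n : int) : i0%:R != 0 :> K -> valz (i0%:R : K) = 0 ->
  v != 0 -> valz v = b -> dv (b%:Z + 1) (v' - v) ->
  dv (n + (e + i0.-1 * b)%N) (A v' - A v) = dv n (v' - v).
Proof.
move=> i0K vi0 v0 vb vv'; have [/andP[i0_gt0 _] a0 va h] := adm.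
pose y := (v' - v) / v; have vy : v' - v = v * y by rewrite mulrC divfK.
have v'E : v' = v * (1 + y) by rewrite mulrDr mulr1 -vy addrC subrK.
have y1 : dv 1 y by rewrite -(dv_val 1 y v0) -vy vb addrC.
have y0 : dv 0 y by apply: dvW y1.
have /choice[t tP] i : exists t, dv 0 t /\ (1 + y) ^+ i - 1 = y * (i%:R + y * t).
  by have [t t0 te] := expr1D_sub1 i y0; exists t.
have Ad i := (tP i).1; have AE i := (tP i).2.
pose T i := alpha i * v ^+ i * (i%:R + y * t i).
have AB : A v' - A v = y * \sum_(i0 <= i < N.+1) T i.
  rewrite /psum -sumrB mulr_sumr; apply: eq_bigr => i _.
  rewrite v'E exprMn.
  have -> : (1 + y) ^+ i = 1 + y * (i%:R + y * t i) by rewrite -AE; ring.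
  rewrite /T; ring.
have [k0 kv] : i0%:R + y * t i0 != 0 /\ valz (i0%:R + y * t i0) = 0.
  by rewrite -vi0; apply: valzD_eq => //; rewrite vi0 add0r dvMr.
have m0 : T i0 != 0 by rewrite /T !mulf_neq0 ?expf_neq0.
have mv : valz (T i0) = (e + i0 * b)%N.
  by rewrite /T !valzM ?mulf_neq0 ?expf_neq0// va kv valzX// vb; lia.
have vb' : dv b v by rewrite dvN0// vb.
have v00 : dv 0 v by apply: dvW vb'.
have [S0 Sv] : \sum_(i0 <= i < N.+1) T i != 0 /\ valz (\sum_(i0 <= i < N.+1) T i) = (e + i0 * b)%N.
  have [/andP[_ hN] _ _ _] := adm; rewrite big_ltn// -mv; apply: valzD_eq => //; rewrite mv.
  rewrite big_nat_cond; apply: dv_sum => i; rewrite andbT => hi.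
  rewrite (_ : (e + i0 * b)%N%:Z + 1 = (e%:Z + 1) + (b * i0)%N); last by rewrite PoszD addrAC mulnC.
  rewrite dvMr//; last by rewrite dvD ?dv_nat// dvMr.
  rewrite dvM ?h//.
  rewrite (_ : i = i0 + (i - i0))%N; last by rewrite subnKC//; case/andP: hi => /ltnW.
  by rewrite exprD dvMr ?dvX// PoszM dvXn.
rewrite AB vy (mulrC y).
(* As [v' - v = v * y], the sum, of valuation [e + i0 * b], is measured against [v], of valuation
   [b]. *)
have -> : n + (e + i0.-1 * b)%N = n - b%:Z + valz (\sum_(i0 <= i < N.+1) T i).
  by rewrite Sv -{2}(prednK i0_gt0) mulSn !PoszD; ring.
by rewrite dv_val// -[in RHS](subrK b%:Z n) -vb dv_val.
Qed.

(** The parameters [e], [i0] and [N] survive rescaling, so bounds expressed through them are uniform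
    in the number of substitutions. *)
Lemma rescale_adm D : admissible e i0 N (rescale D i0 alpha).
Proof.
have [? a0 va h] := adm; split=> //.
- by rewrite /rescale subnn muln0 expr0 mulr1.
- by rewrite /rescale subnn muln0 expr0 mulr1.
- by move=> i hi; rewrite /rescale dvMr ?h// dv_piX0.
Qed.

Lemma psum_pi D u : A (pi ^+ D * u) = pi ^+ (D * i0) * psum i0 N (rescale D i0 alpha) u.
Proof.
rewrite /psum mulr_sumr big_nat_cond [RHS]big_nat_cond; apply: eq_bigr => i.
rewrite andbT => /andP[hi _]; rewrite /rescale exprMn -exprM.
have -> : pi ^+ (D * i) = pi ^+ (D * i0) * pi ^+ (D * (i - i0)).
  by rewrite -exprD -mulnDr subnKC.
ring.
Qed.

(** The coefficient of index [i0] is the same on both sides, and every higher one carries a power of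
    [pi] with exponent at least [k]. *)
Lemma psum_rescale_near (k D : nat) u : (0 < D)%N -> dv 0 u ->
  dv k (psum i0 N (rescale (k.+1 * D) i0 alpha) u - psum i0 N (rescale (k * D) i0 alpha) u).
Proof.
move=> D0 u0; rewrite /psum -sumrB big_nat_cond; apply: dv_sum => i; rewrite andbT => hi.
rewrite -mulrBl dvMr ?dvX// -mulrBr dvMl//.
  by have := adm_dv hi; apply: dvW.
case: (posnP (i - i0)) => [->|ii]; first by rewrite !muln0 subrr dv_0.
have kD l : (l <= l * D * (i - i0))%N by rewrite -mulnA leq_pmulr// muln_gt0 D0.
apply: dvB; rewrite dvN0 ?piX_neq0// valz_piX// lez_nat ?kD//.
exact: leq_trans (leqnSn k) (kD _).
Qed.

End Psum.

Lemma rescaleD D D' i0 alpha : rescale D i0 (rescale D' i0 alpha) =1 rescale (D' + D) i0 alpha.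
Proof. by move=> i; rewrite /rescale -mulrA -exprD -mulnDl. Qed.

End DiagonalSum.

(** * Coefficients over the fundamental domain and their geometric decay *)

Section Coefficients.
Variables (K : localFieldType) (pi : K).
Hypothesis pi_unif : is_uniformizer pi.
Variables (F : numFieldType) (chi : K -> F) (c : nat).
Hypothesis c_gt0 : (0 < c)%N.
Hypothesis chi_c : forall x z, x != 0 -> valz x = 0 -> dv c z -> chi (x + z) = chi x.
Implicit Types (u v w x y z : K) (n : nat).
Local Notation q := (residue_card K).
Local Notation mean := (@mean K pi F).
Local Notation mean2 := (@mean2 K pi F).

(* [chi (ac w)] on the sphere [ord w = n], and 0 elsewhere. *)
Definition phi n w : F :=
  if (w != 0) && (valz w == n) then chi (w / pi ^+ n) else 0.

(** On the sphere of level [n], dividing by [pi ^+ n] turns [z] into a perturbation in $pi^c O_K$,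
    invisible to [chi]; as [c] is positive the sphere itself is preserved. *)
Lemma phiD n w z : dv (n + c)%N z -> phi n (w + z) = phi n w.
Proof.
move=> zn; rewrite /phi valz_perturb; last by apply: dvW zn; lia.
case: ifP => // /andP[w0 /eqP wn]; rewrite mulrDl chi_c//.
- by rewrite mulf_neq0// invr_eq0 (piX_neq0 pi_unif).
- rewrite valzM ?invr_eq0 ?(piX_neq0 pi_unif)// valzV ?(piX_neq0 pi_unif)//.
  by rewrite wn (valz_piX pi_unif) subrr.
- rewrite -(dv_piX pi_unif c n) mulrC divfK ?(piX_neq0 pi_unif)//.
  by rewrite addrC -PoszD.
Qed.

Lemma phi_piX n D w : phi (D + n) (pi ^+ D * w) = phi n w.
Proof.
rewrite /phi mulf_eq0 negb_or (piX_neq0 pi_unif)/=; case: eqVneq => //= w0.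
rewrite valzM ?(piX_neq0 pi_unif)// (valz_piX pi_unif) PoszD (inj_eq (addrI _)).
case: ifP => // _; congr chi; rewrite exprD invfM mulrACA divff ?mul1r//.
exact: piX_neq0.
Qed.

Lemma phi_low n w : dv n.+1 w -> phi n w = 0.
Proof.
move=> h; rewrite /phi; case: ifP => // /andP[w0 /eqP wn].
by move: h; rewrite dvN0// wn lez_nat ltnn.
Qed.

Lemma phi_high n w : ~~ dv n w -> phi n w = 0.
Proof.
move=> h; rewrite /phi; case: ifP => // /andP[w0 /eqP wn].
by move: h; rewrite dvN0// wn lexx.
Qed.

Lemma per_phi n : per (n + c) (phi n).
Proof. by move=> w z _; exact: phiD. Qed.

(** The sphere of level [n.+1] is [pi] times that of level [n], with the same angular components. *)
Lemma mean_phiS n : mean (phi n.+1) = mean (phi n) / q%:R.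
Proof.
transitivity (mean (fun x => if dv 1%N x then phi n.+1 x else 0)).
  apply: (eq_mean pi_unif (@per_phi n.+1)) => x x0.
  by case: ifPn => // h; rewrite phi_high//; apply: contra h; apply: dvW; lia.
rewrite (mean_dv pi_unif 1 (@per_phi n.+1)) expn1; congr (_ / _).
by congr mean; apply/funext => x; rewrite -(phi_piX n 1).
Qed.

Lemma mean_phi_piX n L : (L <= n)%N ->
  mean (fun x => phi n.+1 (pi ^+ L * x)) = mean (fun x => phi n (pi ^+ L * x)) / q%:R.
Proof.
move=> Ln; rewrite -(subnKC Ln) -addnS.
rewrite (_ : (fun x => _) = phi (n - L).+1); last by apply/funext => x; exact: phi_piX.
rewrite (_ : (fun x => phi (L + _) _) = phi (n - L)); last by apply/funext => x; exact: phi_piX.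
exact: mean_phiS.
Qed.

(** Complement in $O_K^2$ of the image of the substitution $(u,v) -> (pi^j0 u, pi^i0 v)$. *)
Definition fundom (i0 j0 : nat) u v : bool := ~~ (dv j0 u && dv i0 v).

Definition coef_on (i0 j0 : nat) (A B : K -> K) n u v : F :=
  if fundom i0 j0 u v then phi n (A u + B v) else 0.

Lemma coef_onC i0 j0 A B n u v : coef_on i0 j0 A B n u v = coef_on j0 i0 B A n v u.
Proof. by rewrite /coef_on /fundom andbC addrC. Qed.

(* On [fundom], [ord g > eA + i0 j0] forces [ord v <= eA + i0 j0], which bounds
   the valuation [eB + (j0 - 1) ord v] of the derivative of [B]. *)
Definition threshold (eA i0 eB j0 : nat) : nat :=
  ((eA + i0 * j0).+1 + (eB + j0 * (eA + i0 * j0)))%N.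

Section TwoSums.
Variables (eA i0 N : nat) (alpha : nat -> K).
Hypothesis admA : admissible eA i0 N alpha.
Variables (eB j0 M : nat) (beta : nat -> K).
Hypothesis admB : admissible eB j0 M beta.
Local Notation A := (psum i0 N alpha).
Local Notation B := (psum j0 M beta).

Lemma per2_phi n : per2 (n + c) (fun u v => phi n (A u + B v)).
Proof.
move=> u v z t u0 v0 z0 t0.
rewrite (_ : A (u + z) + B (v + t) = A u + B v + ((A (u + z) - A u) + (B (v + t) - B v))).
  by apply: phiD; apply: dvD; [exact: (psum_lip admA)|exact: (psum_lip admB)].
by ring.
Qed.

Lemma per2_coef_on n : per2 (n + c + i0 + j0) (coef_on i0 j0 A B n).
Proof.
move=> u v z t u0 v0 z0 t0; rewrite /coef_on /fundom.
rewrite !dvDr; [|by apply: dvW t0; lia|by apply: dvW z0; lia].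
by case: ifP => // _; apply: per2_phi => //; [apply: dvW z0|apply: dvW t0]; lia.
Qed.

Hypothesis j0K : j0%:R != 0 :> K.
Hypothesis valj0 : valz (j0%:R : K) = 0.

(* Hensel's lemma in measure form: on a small disc the diagonal sum is, up to
   scaling, an isometry of O_K, so [phi n] averages as over a ball around 0. *)
Lemma mean_coef_onS_fiber n u : dv 0 u -> (threshold eA i0 eB j0 <= n)%N ->
  mean (coef_on i0 j0 A B n.+1 u) = mean (coef_on i0 j0 A B n u) / q%:R.
Proof.
move=> u0 hn; have [/andP[i0_gt0 _] _ _ _] := admA.
have [/andP[j0_gt0 _] _ _ _] := admB.
(* [L] exceeds [n0], so that a disc of level [L] around [a] with [ord a <= n0] stays on one sphere,
   and is at least [i0], so that [fundom] is constant on each disc. *)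
set n0 := (eA + i0 * j0)%N; pose L := n0.+1.
have i0L : (i0 <= L)%N by rewrite /L /n0 -addnS (leq_trans _ (leq_addl _ _))// leqW// leq_pmulr.
have perF m : per (m + c + i0 + j0) (coef_on i0 j0 A B m u).
  exact: (per2r (@per2_coef_on m)).
rewrite !(mean_split pi_unif L (perF _)) mulrAC; congr (_ / _).
rewrite mulr_suml; apply: eq_big_seq => a /(reps_dv pi_unif) a0.
have domE x : dv 0 x -> fundom i0 j0 u (a + pi ^+ L * x) = fundom i0 j0 u a.
  move=> x0; rewrite /fundom dvDr//; have := dv_piXW pi_unif L x0; apply: dvW; lia.
case dom : (fundom i0 j0 u a); last first.
  by rewrite !mean0 ?mul0r// => x x0; rewrite /coef_on domE// dom.
(* If [v] lies in $pi^L O_K$, the domain forces [ord u < j0]; then [A u] has valuation at most [n0],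
   less than that of [B], so the sum never reaches level [n] and both means vanish. *)
have [aL|aL] := boolP (dv L a).
  suff h m : (n <= m)%N -> mean (fun x => coef_on i0 j0 A B m u (a + pi ^+ L * x)) = 0.
    by rewrite !h// mul0r.
  move=> nm; apply: mean0 => // x x0; rewrite /coef_on domE// dom.
  have /(psum_dv admB) Bv : dv L (a + pi ^+ L * x) by rewrite dvD// dv_piXW.
  have nu : ~~ dv j0 u.
    by move: dom; rewrite /fundom negb_and => /orP[//|/negP[]]; apply: dvW aL; lia.
  have un0 : u != 0 by apply: contraNneq nu => ->; exact: dv_0.
  have [b ub] : exists b : nat, valz u = b.
    by exists `|valz u|%N; rewrite gez0_abs//; move: u0; rewrite dvN0.
  have [Au0 Av] := psum_val admA un0 ub.
  have bj : (b < j0)%N by move: nu; rewrite dvN0// ub lez_nat -ltnNge.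
  have ib : (eA + i0 * b <= n0)%N by rewrite leq_add2l leq_pmul2l// ltnW.
  have L_le : (L <= eB + j0 * L)%N by rewrite (leq_trans _ (leq_addl _ _))// leq_pmull.
  have [s0 sv] : A u + B (a + pi ^+ L * x) != 0 /\ valz (A u + B (a + pi ^+ L * x)) = valz (A u).
    apply: valzD_eq => //; rewrite Av; apply: dvW Bv.
    by move: L_le ib; rewrite /L; lia.
  have nL : (n0 < m)%N by apply: leq_trans nm; apply: leq_trans hn; rewrite /threshold leq_addr.
  by rewrite phi_high// dvN0// sv Av lez_nat -ltnNge (leq_ltn_trans ib).
have an0 : a != 0 by apply: contraNneq aL => ->; exact: dv_0.
have [b ab] : exists b : nat, valz a = b.
  by exists `|valz a|%N; rewrite gez0_abs//; move: a0; rewrite dvN0.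
have bn0 : (b <= n0)%N by move: aL; rewrite dvN0// ab /L; lia.
(* [d] is the valuation of the derivative of [B] at [a]: the disc of level [L] around [a] is mapped
   to level [L + d], and after scaling this map is the isometry [H]. The threshold is chosen to give
   [L + d <= n]. *)
pose d := (eB + j0.-1 * b)%N; pose w0 := A u + B a.
have Ldn : (L + d <= n)%N.
  apply: leq_trans hn; rewrite /threshold leq_add2l leq_add2l.
  by rewrite leq_mul// leq_pred.
pose H x := (B (a + pi ^+ L * x) - B a) / pi ^+ (L + d).
have HE x : pi ^+ (L + d) * H x = B (a + pi ^+ L * x) - B a.
  by rewrite mulrC divfK// piX_neq0.
have near_a x : dv 0 x -> a + pi ^+ L * x != 0 /\ valz (a + pi ^+ L * x) = b.
  move=> x0; rewrite -ab; apply: valzD_eq => //; rewrite ab.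
  by have := dv_piXW pi_unif L x0; apply: dvW; rewrite /L; lia.
have Hdist (k : nat) x y : dv 0 x -> dv 0 y -> dv k (H x - H y) = dv k (x - y).
  move=> x0 y0; rewrite -(dv_piX pi_unif k (L + d)) mulrBr !HE.
  have [y1 y2] := near_a _ y0.
  have -> : B (a + pi ^+ L * x) - B a - (B (a + pi ^+ L * y) - B a) =
     B (a + pi ^+ L * x) - B (a + pi ^+ L * y) by ring.
  rewrite (_ : k%:Z + (L + d)%N = k%:Z + L%:Z + d); last by rewrite PoszD addrA.
  have xyE : a + pi ^+ L * x - (a + pi ^+ L * y) = pi ^+ L * (x - y) by ring.
  rewrite /d (psum_dilation admB _ j0K valj0 y1 y2) xyE.
    exact: dv_piX.
  by have := dv_piXW pi_unif L (dvB x0 y0); apply: dvW; rewrite /L; lia.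
have Hiso : isometry H.
  split=> // x x0; rewrite -[H x]subr0.
  have <- : H 0 = 0 by rewrite /H mulr0 addr0 subrr mul0r.
  by rewrite (Hdist 0%N) ?dv_0// subr0.
have perb m w : per (m + c) (fun y => phi m (w + pi ^+ (L + d) * y)).
  by move=> y z _ z0; rewrite mulrDr addrA; apply: phiD; rewrite dvMl// dv_piX0.
have step m : mean (fun x => coef_on i0 j0 A B m u (a + pi ^+ L * x)) =
              mean (fun y => phi m (w0 + pi ^+ (L + d) * y)).
  rewrite -(mean_iso pi_unif (perb m w0) Hiso); apply: (eq_mean pi_unif (per_sub pi_unif L a0 (perF m))).
  move=> x x0; rewrite /coef_on domE// dom HE; congr phi; rewrite /w0; ring.
rewrite !step.
(* The image disc either contains 0, and a translation makes it a ball around 0, or stays outside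
   $pi^(L+d) O_K$, where [phi] vanishes from level [n] on. *)
have [/(dv_factor pi_unif)[y0 y00 w0E]|w0N] := boolP (dv (L + d)%N w0).
  have tr m : mean (fun y => phi m (w0 + pi ^+ (L + d) * y)) =
              mean (fun y => phi m (pi ^+ (L + d) * y)).
    have tiso : isometry (fun y => y0 + y).
      split=> [x x0|k x y _ _]; first exact: dvD.
      by rewrite (_ : y0 + x - (y0 + y) = x - y)//; ring.
    have p0 : per (m + c) (fun y => phi m (pi ^+ (L + d) * y)).
      by apply: (per_ext _ (perb m 0)) => x _; rewrite add0r.
    rewrite -(mean_iso pi_unif p0 tiso); congr mean; apply/funext => y.
    by rewrite w0E mulrDr.
  by rewrite !tr mean_phi_piX.
have z m : (n <= m)%N -> mean (fun y => phi m (w0 + pi ^+ (L + d) * y)) = 0.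
  move=> nm; apply: mean0 => // y y0; apply: phi_high; apply: contra w0N => h.
  rewrite -(dvDr w0 (dv_piXW pi_unif (L + d) y0)); apply: dvW h.
  by rewrite lez_nat (leq_trans Ldn).
by rewrite !z// mul0r.
Qed.

Lemma mean2_coef_onS_unit n : (threshold eA i0 eB j0 <= n)%N ->
  mean2 (coef_on i0 j0 A B n.+1) = mean2 (coef_on i0 j0 A B n) / q%:R.
Proof.
move=> hn; rewrite mulrC -(meanZ pi_unif _ (per2l pi_unif (@per2_coef_on n))).
apply: (eq_mean pi_unif (per2l pi_unif (@per2_coef_on n.+1))) => u u0.
by rewrite mean_coef_onS_fiber// mulrC.
Qed.

End TwoSums.
End Coefficients.

(** * The recursion obtained from the substitution *)

Section CoefficientRecursion.
Variables (K : localFieldType) (pi : K).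
Hypothesis pi_unif : is_uniformizer pi.
Variables (F : numFieldType) (chi : K -> F) (c : nat).
Hypothesis c_gt0 : (0 < c)%N.
Hypothesis chi_c : forall x z, x != 0 -> valz x = 0 -> dv c z -> chi (x + z) = chi x.
Local Notation q := (residue_card K).
Local Notation mean := (@mean K pi F).
Local Notation mean2 := (@mean2 K pi F).
Local Notation phi := (phi pi chi).
Local Notation coef_on := (coef_on pi chi).

Lemma mean2_coef_onS eA i0 N alpha eB j0 M beta n :
  admissible eA i0 N alpha -> admissible eB j0 M beta ->
  (i0%:R != 0 :> K /\ valz (i0%:R : K) = 0) \/ (j0%:R != 0 :> K /\ valz (j0%:R : K) = 0) ->
  (threshold eA i0 eB j0 + threshold eB j0 eA i0 <= n)%N ->
  mean2 (coef_on i0 j0 (psum i0 N alpha) (psum j0 M beta) n.+1) =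
  mean2 (coef_on i0 j0 (psum i0 N alpha) (psum j0 M beta) n) / q%:R.
Proof.
move=> admA admB [[iK iv]|[jK jv]] hn; last first.
  by apply: (mean2_coef_onS_unit pi_unif c_gt0 chi_c admA admB) => //; lia.
(* When [i0] is the exponent that is a unit, the two variables exchange roles. *)
have swap m : mean2 (coef_on i0 j0 (psum i0 N alpha) (psum j0 M beta) m) =
              mean2 (coef_on j0 i0 (psum j0 M beta) (psum i0 N alpha) m).
  rewrite (mean2_swap pi_unif (per2_coef_on pi_unif c_gt0 chi_c admA admB (n := m))).
  by congr mean2; apply/funext => u; apply/funext => v; rewrite coef_onC.
rewrite !swap; apply: (mean2_coef_onS_unit pi_unif c_gt0 chi_c admB admA) => //; lia.
Qed.

Variables (eA i0 N : nat) (alpha : nat -> K).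
Hypothesis admA : admissible eA i0 N alpha.
Variables (eB j0 M : nat) (beta : nat -> K).
Hypothesis admB : admissible eB j0 M beta.
Hypothesis i0j0_unit :
  (i0%:R != 0 :> K /\ valz (i0%:R : K) = 0) \/ (j0%:R != 0 :> K /\ valz (j0%:R : K) = 0).

(** [Asc k u + Bsc k v] is $g_k(u,v)$: the [k]-fold substitution in $g$, divided by $pi^(k i0
    j0)$. *)
Definition Asc (k : nat) := psum i0 N (rescale pi (k * j0) i0 alpha).
Definition Bsc (k : nat) := psum j0 M (rescale pi (k * i0) j0 beta).

Let admAk k : admissible eA i0 N (rescale pi (k * j0) i0 alpha).
Proof. exact: rescale_adm. Qed.
Let admBk k : admissible eB j0 M (rescale pi (k * i0) j0 beta).
Proof. exact: rescale_adm. Qed.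

(** The coefficient of $q^(-ns)$ in the zeta function of $g_k$; [dcoef] is the share of the
    fundamental domain in it. *)
Definition zcoef (k n : nat) : F := mean2 (fun u v => phi n (Asc k u + Bsc k v)).
Definition dcoef (k n : nat) : F := mean2 (coef_on i0 j0 (Asc k) (Bsc k) n).

Lemma dcoefS k n : (threshold eA i0 eB j0 + threshold eB j0 eA i0 <= n)%N ->
  dcoef k n.+1 = q%:R^-1 * dcoef k n.
Proof. by move=> hn; rewrite mulrC; exact: (mean2_coef_onS (admAk k) (admBk k)). Qed.

(** The bound on [k] is uniform in [n]: up to [n1], $g_(k+1)$ and $g_k$ agree modulo $pi^(n+c)$, and
    beyond [n1] both sides follow the same geometric recursion. *)
Lemma dcoef_stable k n :
  (threshold eA i0 eB j0 + threshold eB j0 eA i0 + c <= k)%N ->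
  dcoef k.+1 n = dcoef k n.
Proof.
set n1 := (threshold eA i0 eB j0 + _)%N => hk.
have [/andP[i0_gt0 _] _ _ _] := admA; have [/andP[j0_gt0 _] _ _ _] := admB.
have low m : (m <= n1)%N -> dcoef k.+1 m = dcoef k m.
  move=> mn; apply: (eq_mean2 pi_unif (per2_coef_on pi_unif c_gt0 chi_c (admAk k.+1) (admBk k.+1) (n := m))).
  move=> u v u0 v0; rewrite /coef_on; case: ifP => // _.
  have := psum_rescale_near pi_unif admA k j0_gt0 u0.
  have := psum_rescale_near pi_unif admB k i0_gt0 v0.
  rewrite -/(Asc k) -/(Asc k.+1) -/(Bsc k) -/(Bsc k.+1) => hB hA.
  have -> : Asc k.+1 u + Bsc k.+1 v =
    Asc k u + Bsc k v + ((Asc k.+1 u - Asc k u) + (Bsc k.+1 v - Bsc k v)) by ring.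
  apply: (phiD pi_unif c_gt0 chi_c).
  by apply: (@dvW _ k); [lia|exact: dvD].
have [/low//|n1n] := leqP n n1.
rewrite -(subnKC (ltnW n1n)); elim: (n - n1)%N => [|m IH]; first by rewrite addn0 low.
have le : (n1 <= n1 + m)%N by rewrite leq_addr.
by rewrite addnS (dcoefS k.+1 le) (dcoefS k le) IH.
Qed.

(** The complement of the domain is the image of the substitution, whose Jacobian is $q^(-(i0+j0))$
    and which turns $g_k$ into $pi^(i0 j0) g_(k+1)$. *)
Lemma zcoef_rec k n : zcoef k n = dcoef k n +
  (if (i0 * j0 <= n)%N then (q ^ (i0 + j0))%:R^-1 * zcoef k.+1 (n - i0 * j0) else 0).
Proof.
have [/andP[i0_gt0 _] _ _ _] := admA; have [/andP[j0_gt0 _] _ _ _] := admB.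
pose f u v := phi n (Asc k u + Bsc k v).
have fP : per2 (n + c) f := per2_phi pi_unif c_gt0 chi_c (admAk k) (admBk k) (n := n).
have fP' : per2 (n + c + i0 + j0) f.
  by move=> u v z t u0 v0 z0 t0; apply: fP => //; [apply: dvW z0|apply: dvW t0]; lia.
have dP := per2_coef_on pi_unif c_gt0 chi_c (admAk k) (admBk k) (n := n).
pose g u v := if dv j0 u && dv i0 v then f u v else 0.
have gP : per2 (n + c + i0 + j0) g.
  move=> u v z t u0 v0 z0 t0; rewrite /g.
  have zj : dv j0 z by apply: dvW z0; lia.
  have ti : dv i0 t by apply: dvW t0; lia.
  rewrite (dvDr u zj) (dvDr v ti).
  by case: ifP => // _; apply: fP'.
have -> : zcoef k n = dcoef k n + mean2 g.
  rewrite /dcoef -(mean2D pi_unif dP gP); apply: (eq_mean2 pi_unif fP') => u v _ _.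
  by rewrite /coef_on /fundom /g; case: (_ && _); rewrite /= ?add0r ?addr0.
congr (_ + _).
(* The change of variables is made one coordinate at a time by [mean_dv], first in [v], then in
   [u]. *)
pose h u := mean (fun v => f u (pi ^+ i0 * v)) / (q ^ i0)%:R.
have inner u : dv 0 u -> mean (g u) = if dv j0 u then h u else 0.
  move=> u0; rewrite /g; case: (dv j0 u) => /=; last by apply: mean0.
  exact: (mean_dv pi_unif i0 (per2r fP u0)).
have hP : per (n + c) h.
  move=> x z x0 z0; rewrite /h; congr (_ / _).
  have xz0 : dv 0 (x + z) by rewrite dvD//; apply: dvW z0.
  apply: (@eq_mean _ _ pi_unif _ (n + c)).
    apply: (per_ext (f := fun v => f (x + z) (0 + pi ^+ i0 * v))).
      by move=> v _; rewrite add0r.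
    by apply: (per_sub pi_unif); [exact: dv_0|exact: per2r fP xz0].
  move=> v v0; have := fP x (pi ^+ i0 * v) z 0 x0 _ z0 (dv_0 _ _).
  by rewrite addr0; apply; rewrite dvMl// dv_piX0.
have -> : mean2 g = mean (fun u => if dv j0 u then h u else 0).
  by apply: (eq_mean pi_unif (per2l pi_unif gP)).
rewrite (mean_dv pi_unif j0 hP).
have fE u v : f (pi ^+ j0 * u) (pi ^+ i0 * v) = phi n (pi ^+ (i0 * j0) * (Asc k.+1 u + Bsc k.+1 v)).
  rewrite /f /Asc /Bsc !psum_pi mulnC -mulrDr; congr (phi n (_ * (_ + _)));
    by congr psum; apply/funext => i; rewrite rescaleD mulSn addnC.
have fP2 : per2 (n + c) (fun u v => f (pi ^+ j0 * u) (pi ^+ i0 * v)).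
  move=> x y z t x0 y0 z0 t0; rewrite !mulrDr.
  by apply: fP; rewrite dvMl// dv_piX0.
have -> : mean (fun u => h (pi ^+ j0 * u)) / (q ^ j0)%:R =
    (q ^ (i0 + j0))%:R^-1 * mean2 (fun u v => f (pi ^+ j0 * u) (pi ^+ i0 * v)).
  rewrite /h expnD natrM invfM [RHS]mulrC mulrA; congr (_ / _).
  rewrite mulrC -(meanZ pi_unif _ (per2l pi_unif fP2)).
  by congr mean; apply/funext => u; rewrite mulrC.
case: ifPn => [Dn|Dn].
  congr (_ * _); apply: (eq_mean2 pi_unif fP2) => u v _ _.
  by rewrite fE -{1}(subnKC Dn) phi_piX.
(* Below level [i0 * j0] nothing remains, since after the substitution all values are divisible by
   $pi^(i0 j0)$. *)
rewrite (_ : mean2 _ = 0) ?mulr0//; apply: mean0 => // u u0; apply: mean0 => // v v0.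
rewrite fE phi_low//.
apply: (@dvW _ (i0 * j0)%N); first by rewrite lez_nat ltnNge.
rewrite dv_piXW// dvD//; [exact: (psum_int (admAk _))|exact: (psum_int (admBk _))].
Qed.

End CoefficientRecursion.

(** * Rationality of series with eventually recurrent coefficients *)

Section RationalSeries.
Variable F : numFieldType.
Implicit Types (u : nat -> F) (t Z r rho : F).

Definition partial_series u t (n : nat) : F := \sum_(i < n) u i * t ^+ i.

(* [u] is eventually annihilated by [(1 - r S) (1 - rho S^D)], S the shift. *)
Definition eventually_rec (r rho : F) (D : nat) u : Prop :=
  exists N : nat, forall m, (N <= m)%N ->
    u (m + D).+1 - rho * u m.+1 - r * (u (m + D)%N - rho * u m) = 0.

(** Descending induction from [k0]. At [k0] the family is stationary, so $1 - rho S^D$ leaves [d],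
    which $1 - r S$ kills; each step down adds a geometric tail to [rho] times a shifted
    solution. *)
Lemma eventually_rec_iter r rho D (C d : nat -> nat -> F) (n1 k0 : nat) :
  (0 < D)%N ->
  (forall k n, C k n = d k n + (if (D <= n)%N then rho * C k.+1 (n - D)%N else 0)) ->
  (forall k n, (n1 <= n)%N -> d k n.+1 = r * d k n) ->
  (forall k n, (k0 <= k)%N -> d k.+1 n = d k n) ->
  eventually_rec r rho D (C 0%N).
Proof.
move=> D0 Crec dS dst.
have CD k n : C k (n + D)%N = d k (n + D)%N + rho * C k.+1 n.
  by rewrite Crec leq_addl addnK.
have Cst k n : (k0 <= k)%N -> C k.+1 n = C k n.
  move=> hk; elim/ltn_ind: n k hk => n IH k hk; rewrite Crec (Crec k) dst//.
  by case: ifP => // Dn; rewrite IH// ?ltn_subrL ?D0 ?(leq_trans D0)// leqW.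
suff: forall j, eventually_rec r rho D (C (k0 - j)%N) by move=> /(_ k0); rewrite subnn.
elim=> [|j [N hN]].
  exists n1 => m hm; rewrite subn0 -addSn !(CD k0) !Cst//.
  rewrite addSn dS ?(leq_trans hm (leq_addr _ _))//; ring.
(* Once [j] reaches [k0] the truncated subtraction stays at 0 and there is nothing to do. *)
have [kj|kj] := ltnP j k0; last first.
  by move: kj; rewrite -subn_eq0 => /eqP kj; exists N => m hm; rewrite subnS -(hN _ hm) kj.
have kE : (k0 - j = (k0 - j.+1).+1)%N by rewrite -subnSK.
exists (n1 + N + D)%N => m hm; rewrite kE in hN.
move: (k0 - j.+1)%N hN => k hN.
have Dm : (D <= m)%N by apply: leq_trans hm; rewrite leq_addl.
have hm' : (n1 + N <= m - D)%N by rewrite leq_subRL// addnC.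
rewrite -(subnK Dm); set l := (m - D)%N in hm' *.
rewrite -!addSn !(CD k).
have hn1 : (n1 <= l)%N := leq_trans (leq_addr _ _) hm'.
have e1 : d k (l + D + D).+1 = r * d k (l + D + D)%N by rewrite dS// -addnA (leq_trans hn1)// leq_addr.
have e2 : d k (l + D).+1 = r * d k (l + D)%N by rewrite dS// (leq_trans hn1)// leq_addr.
have e3 := hN l (leq_trans (leq_addl _ _) hm').
rewrite !addSn e1 e2.
transitivity (rho * 0 : F); last by rewrite mulr0.
rewrite -e3; ring.
Qed.

(** Multiplying the series by the two factors leaves only finitely many defects of the recurrence
    and some initial terms. These form a polynomial in which [t] is the variable, so one [G] serves
    all [t]. *)
Lemma rational_series r rho D u : eventually_rec r rho D u ->
  exists G : {poly F}, forall t Z, partial_series u t n @[n --> \oo] --> (Z : F) ->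
    (1 - r * t) * (1 - rho * t ^+ D) * Z = G.[t].
Proof.
move=> [N hN].
pose w m := u (m + D).+1 - rho * u m.+1 - r * (u (m + D)%N - rho * u m).
pose P n : {poly F} := \sum_(i < n) (u i)%:P * 'X^i.
pose G := (\sum_(m < N) (w m)%:P * 'X^((m + D).+1)) + P D.+1
  - rho%:P * 'X^D * (u 0%N)%:P - r%:P * 'X * P D.
exists G => t Z cvgZ.
have PE n : (P n).[t] = partial_series u t n.
  by rewrite horner_sum; apply: eq_bigr => i _; rewrite hornerM hornerXn hornerC.
pose E n := \sum_(m < n) w m * t ^+ (m + D).+1.
have EE n : E n = (partial_series u t (n + D.+1)%N - partial_series u t D.+1)
   - rho * t ^+ D * (partial_series u t (n + 1)%N - u 0%N)
   - r * t * (partial_series u t (n + D)%N - partial_series u t D)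
   + r * rho * t ^+ D.+1 * partial_series u t n.
  elim: n => [|n IH].
    rewrite /E /partial_series big_ord0 !add0n big_ord1 big_ord0 expr0; ring.
  rewrite /E big_ord_recr/= -/(E n) IH !addSn /partial_series !big_ord_recr/= -/(partial_series u t _).
  rewrite addn1 addnS /w !exprS exprD; ring.
(* All shifted partial sums tend to [Z], so [E] tends to the product of the two factors and [Z], up
   to initial terms; it is also constant from [N] on. *)
have cvgE : E n @[n --> \oo] --> ((Z - partial_series u t D.+1)
   - rho * t ^+ D * (Z - u 0%N) - r * t * (Z - partial_series u t D)
   + r * rho * t ^+ D.+1 * Z : F).
  have cvgk k : partial_series u t (n + k)%N @[n --> \oo] --> (Z : F).
    by have := cvgZ; rewrite -(cvg_shiftn k).
  rewrite (funext EE).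
  apply: cvgD; last by apply: cvgMl_tmp.
  apply: cvgB; last by apply: cvgMl_tmp; apply: cvgB => //; exact: cvg_cst.
  apply: cvgB; last by apply: cvgMl_tmp; apply: cvgB => //; exact: cvg_cst.
  by apply: cvgB => //; exact: cvg_cst.
have cvgE' : E n @[n --> \oo] --> (E N : F).
  rewrite -(cvg_shiftn N) (_ : (fun n => _) = fun=> E N); first exact: cvg_cst.
  apply/funext => n; rewrite /= /E addnC; elim: n => [|n IH]; first by rewrite addn0.
  by rewrite addnS big_ord_recr/= IH /w hN ?leq_addr// mul0r addr0.
have h := cvg_unique (@norm_hausdorff _ _) cvgE cvgE'.
have -> : G.[t] = E N + partial_series u t D.+1 - rho * t ^+ D * u 0%N - r * t * partial_series u t D.
  rewrite /G !hornerE !PE horner_sum /E; do ?congr (_ + _); apply: eq_bigr => i _.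
  by rewrite !hornerE.
by rewrite -h exprS; ring.
Qed.

End RationalSeries.

(** * Complex powers of positive reals *)

Section ComplexPowers.
Variable R : realType.
Implicit Types (x y : R) (z s : R[i]).

(** The complex exponential of $x + iy$. *)
Definition expi x y : R[i] := (expR x * cos y) +i* (expR x * sin y).

Lemma expiD x x' y y' : expi (x + x') (y + y') = expi x y * expi x' y'.
Proof.
rewrite /expi expRD cosD sinD; simpc; congr (_ +i* _); ring.
Qed.

Lemma expi0 : expi 0 0 = 1.
Proof. by rewrite /expi expR0 cos0 sin0 mulr1 mulr0. Qed.

Lemma expiX x y n : expi x y ^+ n = expi (x *+ n) (y *+ n).
Proof.
by elim: n => [|n IH]; rewrite ?expi0// exprS IH -expiD !mulrS.
Qed.

Lemma cpowE (a : R) s : cpow a s = expi (complex.Re s * ln a) (complex.Im s * ln a).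
Proof. by []. Qed.

Lemma expi_inv (a : R) : 0 < a -> expi (- ln a) 0 = (a^-1)%:C.
Proof.
by move=> a0; rewrite /expi cos0 sin0 mulr1 mulr0 expRN lnK.
Qed.

Lemma cpow_nat (a : R) (m n : nat) s : 0 < a ->
  cpow a (- m%:R - n%:R * s) = a%:C ^- m * cpow a (- s) ^+ n.
Proof.
move=> a0; case: s => x y; rewrite !cpowE expiX -exprVn.
have -> : a%:C^-1 = expi (- ln a) 0 by rewrite expi_inv// fmorphV.
rewrite expiX -expiD.
rewrite -!(rmorph_nat (real_complex R)) /=; congr expi.
  rewrite -[- ln a *+ m]mulr_natr -[(- x * ln a) *+ n]mulr_natr; ring.
rewrite mul0rn -[(- y * ln a) *+ n]mulr_natr; ring.
Qed.

(** For [a = q] this makes $|x|^s$ on the sphere of level [n] the [n]-th power of $q^(-s)$. *)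
Lemma cpowV_nat (a : R) (n : nat) s : 0 < a ->
  cpow (a ^ (- n%:Z)) s = cpow a (- s) ^+ n.
Proof.
move=> a0; case: s => x y; rewrite !cpowE expiX /=.
have -> : ln (a ^ (- n%:Z)) = - (ln a *+ n).
  by rewrite -exprnN lnV ?posrE ?exprn_gt0// lnXn.
congr expi; rewrite mulrN -mulrnAr; ring.
Qed.

End ComplexPowers.

(** * Absence of small subgroups in the multiplicative group of complex numbers *)

Section NoSmallSubgroups.
Variable R : realType.
Implicit Types (z w : R[i]).

(** The modulus as an element of [R], whereas the norm of [R[i]] takes values in [R[i]]. *)
Definition cabs z : R := Num.sqrt (complex.Re z ^+ 2 + complex.Im z ^+ 2).

Lemma cabsE z : `|z| = (cabs z)%:C.
Proof. exact: normc_def. Qed.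

Lemma cabsM z w : cabs (z * w) = cabs z * cabs w.
Proof. by apply: (@complexI R); rewrite rmorphM/= -!cabsE normrM. Qed.

Lemma cabs_ge0 z : 0 <= cabs z. Proof. exact: sqrtr_ge0. Qed.

(* Squaring expands distances to 1 by at least 3/2 near 1. *)
Lemma eq1_of_near_powers z : (forall n, cabs (z ^+ n - 1) < 2^-1) -> z = 1.
Proof.
move=> h; apply/eqP; rewrite -subr_eq0; apply/eqP.
suff : cabs (z - 1) = 0.
  by move=> e; apply/eqP; rewrite -normr_eq0 cabsE e.
apply/eqP; rewrite eq_le cabs_ge0 andbT leNgt; apply/negP => d0.
(* A squaring multiplies the distance to 1 by [cabs (w + 1)], at least 2 - 1/2. The linear bound of
   Bernoulli type already exceeds 1/2 for large [k]. *)
have grow k : (1 + k%:R / 2) * cabs (z - 1) <= cabs (z ^+ (2 ^ k) - 1).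
  elim: k => [|k IH]; first by rewrite expn0 expr1 mul0r addr0 mul1r.
  set w := z ^+ (2 ^ k) in IH *.
  have -> : z ^+ (2 ^ k.+1) - 1 = (w - 1) * (w + 1).
    by rewrite expnS mulnC exprM -/w; ring.
  have w1 : cabs (w - 1) < 2^-1 := h _.
  have w2 : 3 / 2 <= cabs (w + 1).
    have : `|2 : R[i]| <= `|w + 1| + `|w - 1|.
      by rewrite (_ : 2 = (w + 1) - (w - 1)) ?ler_normB//; ring.
    rewrite !cabsE -rmorphD/= lecR.
    have -> : cabs 2 = 2.
      by apply: (@complexI R); rewrite -cabsE normr_nat rmorph_nat.
    by move: w1; lra.
  rewrite cabsM -natr1.
  have := cabs_ge0 (w - 1).
  have : 0 <= (k%:R : R) by [].
  move: IH w2 d0; set a := cabs (w - 1); set b := cabs (w + 1); set e := cabs (z - 1).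
  move=> IH w2 d0 k0 a0; nra.
pose k := Num.bound (cabs (z - 1))^-1.
have kP : (cabs (z - 1))^-1 < k%:R.
  by apply: archi_boundP; rewrite invr_ge0 ltW.
have k1 : 1 < k%:R * cabs (z - 1) by rewrite -ltr_pdivrMr// mul1r.
have := le_lt_trans (grow k) (h _).
by move: k1 d0; nra.
Qed.

End NoSmallSubgroups.

(** * Finite conductor of a continuous character *)

Section Conductor.
Variables (R : realType) (K : localFieldType) (chi : K -> R[i]).
Hypothesis chiP : is_character chi.

Lemma unit_near1 (x : K) : dv 1 (x - 1) -> unit_integers x.
Proof.
move=> h; apply/unit_integersE; rewrite -(subrK 1 x) addrC.
have [|-> ->] := @valzD_eq K 1 (x - 1) (oner_neq0 K); first by rewrite valz1.
by rewrite valz1.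
Qed.

Lemma unit1 : unit_integers (1 : K).
Proof. by apply: unit_near1; rewrite subrr dv_0. Qed.

Lemma chi1 : chi 1 = 1.
Proof.
have [chi0 chiM _] := chiP; apply: (mulfI (chi0 _ unit1)).
by rewrite -chiM ?mulr1//; exact: unit1.
Qed.

Lemma chi_near1 : exists c : nat, (0 < c)%N /\
  forall x, dv c (x - 1) -> cabs (chi x - 1) < 2^-1.
Proof.
have [_ _ /subspace_continuousP /(_ _ unit1) chic] := chiP.
have e0 : 0 < (2^-1 : R)%:C :> R[i] by rewrite ltcR invr_gt0.
move/cvgrPdist_lt : chic => /(_ _ e0); rewrite near_withinE.
rewrite /prop_near1 -nbhs_entourageE => -[E /entourage_ord[m mE] EU].
(* [m] may be negative; the extra 1 keeps [x] in $1 + pi O_K$, hence among the units, where [chi] is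
   continuous. *)
exists (`|m| + 1)%N; split=> [|x xc]; first by rewrite addn1.
have x1 : dv 1 (x - 1) by apply: dvW xc; lia.
suff: `|chi 1 - chi x| < (2^-1)%:C by rewrite chi1 distrC cabsE ltcR.
apply: (EU x _ (unit_near1 x1)); rewrite /xsection/= inE; apply: mE => /=.
by rewrite -dvE dvC; apply: dvW xc; lia.
Qed.

(** $1 + pi^c O_K$ is stable under powers, so all powers of a value of [chi] on it stay near 1 and
    [eq1_of_near_powers] applies; multiplicativity carries this to every unit. *)
Lemma conductor : exists c : nat, (0 < c)%N /\
  forall x z, x != 0 -> valz x = 0 -> dv c z -> chi (x + z) = chi x.
Proof.
have [c [c0 chic]] := chi_near1; have [_ chiM _] := chiP.
exists c; split=> // x z x0 vx zc.
have y1 : dv c (1 + z / x - 1).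
  rewrite addrC addKr dvMr// dvN0 ?invr_eq0// valzV// vx.
  by [].
have near1X n (y : K) : dv c (y - 1) -> dv c (y ^+ n - 1).
  move=> h; elim: n => [|n IH]; first by rewrite expr0 subrr dv_0.
  rewrite exprS (_ : _ - 1 = (y - 1) * y ^+ n + (y ^+ n - 1)); last by ring.
  rewrite dvD// dvMr// dvX// -(subrK 1 y) dvD ?dv1//.
  by apply: dvW h.
have cu (y : K) : dv c (y - 1) -> unit_integers y.
  by move=> h; apply: unit_near1; apply: dvW h; rewrite lez_nat.
have chiX n (y : K) : dv c (y - 1) -> chi (y ^+ n) = chi y ^+ n.
  move=> h; elim: n => [|n IH]; first by rewrite !expr0 chi1.
  by rewrite !exprS chiM ?IH//; apply: cu => //; exact: near1X.
have -> : x + z = x * (1 + z / x) by rewrite mulrDr mulr1 mulrC divfK.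
rewrite chiM; [|by apply/unit_integersE; rewrite x0 vx eqxx|exact: cu].
rewrite (_ : chi (1 + z / x) = 1) ?mulr1//.
by apply: eq1_of_near_powers => n; rewrite -chiX//; apply: chic; exact: near1X.
Qed.

End Conductor.

(** * Haar integrals of locally constant functions on $O_K^2$ *)

Section HaarIntegral.
Variables (R : realType) (K : localFieldType) (pi : K).
Hypothesis pi_unif : is_uniformizer pi.
Variable mu : {measure set (borel K 2) -> \bar R}.
Hypothesis mu_haar : is_normalized_haar mu.
Local Notation q := (residue_card K).
Local Notation O2 := (@integers_pow K 2 : set (borel K 2)).

Definition ball2 (m : nat) (p : K * K) : set (borel K 2) :=
  [set x : 'rV[K]_2 | dv m (x ord0 0 - p.1) /\ dv m (x ord0 1 - p.2)].

Lemma ball2_O2 : ball2 0 (0, 0) = O2.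
Proof.
apply/seteqP; split => x; rewrite /ball2 /integers_pow/= !subr0.
  move=> [h0 h1] i; rewrite integersE.
  have [->//|->//] : i = 0 \/ i = 1.
  by case: i => -[|[|//]] ?; [left|right]; exact: val_inj.
by move=> h; split; rewrite -integersE; exact: h.
Qed.

Lemma measurable_ball2 m p : measurable (ball2 m p).
Proof.
apply: sub_sigma_algebra; rewrite openE => x [x0 x1].
(* A ball contains with each point a box of neighbourhoods of its coordinates, hence is open. *)
exists (fun i j => [set y | dv m (y - x i j)]).
  move=> i j; rewrite -nbhs_entourageE.
  exists [set xy : K * K | dv m (xy.1 - xy.2)].
    by apply/entourage_ord; exists m => -[a b] /=; rewrite -dvE.
  by move=> y; rewrite /xsection/= inE/= dvC.
move=> y /= h; split.
  by rewrite -(subrK (x ord0 0) (y ord0 0)) -addrA dvD//; exact: h.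
by rewrite -(subrK (x ord0 1) (y ord0 1)) -addrA dvD//; exact: h.
Qed.

Lemma measurable_O2 : measurable O2.
Proof. by rewrite -ball2_O2; exact: measurable_ball2. Qed.

Lemma mu_O2 : mu O2 = 1%E. Proof. exact: mu_haar.2. Qed.

Lemma mu_ball2 m p : mu (ball2 m p) = mu (ball2 m (0, 0)).
Proof.
pose a : 'rV[K]_2 := \row_j (if j == 0 then p.1 else p.2).
rewrite -(mu_haar.1 a _ (measurable_ball2 m (0, 0))); congr (mu _).
apply/seteqP; split => x /=.
  rewrite {1}/ball2/= => -[h0 h1]; exists (x - a); last by rewrite addrC subrK.
  by rewrite /ball2/= !mxE !subr0.
move=> [y]; rewrite /ball2/= !subr0 => -[h0 h1] <-; rewrite !mxE/=.
by split; rewrite addrAC subrr add0r.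
Qed.

Definition pairs (m : nat) : seq (K * K) := [seq (a, b) | a <- reps pi m, b <- reps pi m].

Lemma ball2_pairs m (x : borel K 2) : O2 x ->
  exists2 p, p \in pairs m & forall p', p' \in pairs m -> ball2 m p' x <-> p' = p.
Proof.
move=> xO; have xd i : dv 0 ((x : 'rV[K]_2) ord0 i) by rewrite -integersE; exact: xO.
have [a aR xa] := reps_ex pi_unif m (xd 0); have [b bR xb] := reps_ex pi_unif m (xd 1).
exists (a, b); first by apply/allpairsP; exists (a, b).
move=> p' /allpairsP[[a' b']/= [a'R b'R ->]]; split=> [[/= h0 h1]|[-> ->]//].
congr pair; [apply: (reps_sep pi_unif a'R aR)|apply: (reps_sep pi_unif b'R bR)].
  by rewrite -(subrK ((x : 'rV[K]_2) ord0 0) a') -addrA dvD// dvC.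
by rewrite -(subrK ((x : 'rV[K]_2) ord0 1) b') -addrA dvD// dvC.
Qed.

Lemma pairs_uniq m : uniq (pairs m).
Proof. by apply: allpairs_uniq => [||[? ?] [? ?] _ _]; rewrite ?reps_uniq. Qed.

Lemma pairs_sub m p : p \in pairs m -> ball2 m p `<=` O2.
Proof.
move=> /allpairsP[[a b]/= [/(reps_dv pi_unif) a0 /(reps_dv pi_unif) b0 ->]].
rewrite -ball2_O2 => x [/= h0 h1]; split; rewrite /= subr0.
  by rewrite -(subrK a ((x : 'rV[K]_2) ord0 0)) dvD//; apply: dvW h0.
by rewrite -(subrK b ((x : 'rV[K]_2) ord0 1)) dvD//; apply: dvW h1.
Qed.

Lemma integrable_bounded (f : borel K 2 -> R) (B : R) : measurable_fun O2 f ->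
  (forall x, O2 x -> `|f x| <= B) -> mu.-integrable O2 (EFin \o f).
Proof.
move=> mf fB; apply: measurable_bounded_integrable => //.
- exact: measurable_O2.
- by rewrite [X in (X < _)%E]mu_O2 ltry.
- exists B; split; first exact: num_real.
  by move=> y By x xO /=; rewrite (le_trans (fB x xO))// ltW.
Qed.

Definition step_fun (s : seq (K * K)) (m : nat) (c : K * K -> R) (x : borel K 2) : R :=
  \sum_(p <- s) c p * \1_(ball2 m p) x.

Lemma measurable_step_fun s m c : measurable_fun O2 (step_fun s m c).
Proof.
apply: measurable_sum => p; apply: measurable_funM; first exact: measurable_cst.
by apply: measurable_indic; exact: measurable_ball2.
Qed.

Lemma integrable_step_fun s m c : mu.-integrable O2 (EFin \o step_fun s m c).
Proof.
apply: (@integrable_bounded _ (\sum_(p <- s) `|c p|)); first exact: measurable_step_fun.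
move=> x _; apply: le_trans (ler_norm_sum _ _ _) _; apply: ler_sum => p _.
rewrite normrM ler_piMr// indicE normr_nat.
by case: (_ \in _).
Qed.

Lemma Rintegral_step_fun s m c : \int[mu]_(x in O2) step_fun s m c x =
  \sum_(p <- s) c p * fine (mu (ball2 m p `&` O2)).
Proof.
elim: s => [|p s IH].
  rewrite big_nil /step_fun; under eq_Rintegral do rewrite big_nil.
  by rewrite Rintegral_cst ?mul0r//; exact: measurable_O2.
rewrite big_cons -IH.
have int1 : mu.-integrable O2 (EFin \o (\1_(ball2 m p) : borel K 2 -> R)).
  have := integrable_step_fun [:: p] m (fun=> 1).
  by apply: eq_integrable; [exact: measurable_O2|move=> x _ /=; rewrite /step_fun big_seq1 mul1r].
have int2 : mu.-integrable O2 (EFin \o (fun x => c p * \1_(ball2 m p) x)).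
  have := integrable_step_fun [:: p] m c.
  by apply: eq_integrable; [exact: measurable_O2|move=> x _ /=; rewrite /step_fun big_seq1].
rewrite /step_fun; under eq_Rintegral do rewrite big_cons.
rewrite RintegralD//; [|exact: measurable_O2|exact: integrable_step_fun].
rewrite RintegralZl//; last exact: measurable_O2.
by rewrite {1}/Rintegral integral_indic//; [exact: measurable_O2|exact: measurable_ball2].
Qed.

Lemma step_funE m (psi : K * K -> R) (x : 'rV[K]_2) :
  (forall p, p \in pairs m -> ball2 m p x -> psi (x ord0 0, x ord0 1) = psi p) ->
  O2 x -> psi (x ord0 0, x ord0 1) = step_fun (pairs m) m psi x.
Proof.
move=> psiP xO; have [p pP pU] := ball2_pairs m xO.
rewrite /step_fun (bigD1_seq p) ?pairs_uniq//= big1_seq ?addr0.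
  rewrite (psiP p pP); last exact/pU.
  by rewrite indicE mem_set ?mulr1//; exact/pU.
move=> p' /andP[p'p p'P]; rewrite indicE memNset ?mulr0//.
by move=> /(pU _ p'P) /eqP; rewrite (negbTE p'p).
Qed.

(** The $q^(2m)$ balls of level [m] partition $O_K^2$ and are translates of one another; integrating
    1 gives their common measure. *)
Lemma fine_mu_ball2 m p : fine (mu (ball2 m p)) = ((q ^ m)%:R ^+ 2)^-1.
Proof.
rewrite mu_ball2.
have : \int[mu]_(x in O2) step_fun (pairs m) m (fun=> 1) x = 1.
  rewrite (@eq_Rintegral _ _ _ mu O2 (fun=> 1)).
    rewrite Rintegral_cst; last exact: measurable_O2.
    by rewrite [X in fine X]mu_O2 mulr1.
  by move=> x /set_mem xO; rewrite -(@step_funE m (fun=> 1) x).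
rewrite Rintegral_step_fun.
rewrite (eq_big_seq (fun=> fine (mu (ball2 m (0, 0))))); last first.
  by move=> p' p'P; rewrite mul1r setIidl ?mu_ball2//; exact: pairs_sub.
rewrite big_const_seq count_predT size_allpairs size_reps iter_addr_0.
rewrite -[_ *+ (_ * _)]mulr_natr natrM -expr2 => h.
have qn : (q ^ m)%:R ^+ 2 != 0 :> R by rewrite expf_neq0// qX_neq0.
by apply: (mulIf qn); rewrite h mulVf.
Qed.

(** A function periodic modulo $pi^M$ is a step function on balls of equal measure, so its integral
    is the finite average defining [mean2]. *)
Lemma haar_mean_real M (f : K -> K -> R) : per2 M f ->
  measurable_fun O2 (fun x : 'rV[K]_2 => f (x ord0 0) (x ord0 1)) /\
  \int[mu]_(x in O2) f ((x : 'rV[K]_2) ord0 0) ((x : 'rV[K]_2) ord0 1) = mean2 pi f.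
Proof.
move=> fM; pose psi p := f p.1 p.2.
have psiE (x : 'rV[K]_2) : O2 x -> f (x ord0 0) (x ord0 1) = step_fun (pairs M) M psi x.
  move=> xO; rewrite -[LHS]/(psi (x ord0 0, x ord0 1)); apply: step_funE => //.
  move=> [a b] /allpairsP[[a' b']/= [/(reps_dv pi_unif) a0 /(reps_dv pi_unif) b0 [-> ->]]].
  move=> [/= h0 h1]; rewrite /psi/=.
  rewrite -(subrK a' (x ord0 0)) -(subrK b' (x ord0 1)) ![_ - _ + _]addrC.
  exact: fM.
split.
  apply: (eq_measurable_fun (step_fun (pairs M) M psi)); last exact: measurable_step_fun.
  by move=> x /set_mem /psiE ->.
rewrite (@eq_Rintegral _ _ _ mu O2 (step_fun (pairs M) M psi)); last first.
  by move=> x /set_mem /psiE ->.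
rewrite Rintegral_step_fun (mean2E pi_unif fM (leqnn M)) /avg.
rewrite (eq_big_seq (fun p => psi p * ((q ^ M)%:R ^+ 2)^-1)); last first.
  by move=> p pP; rewrite setIidl ?fine_mu_ball2//; exact: pairs_sub.
rewrite -!big_distrl/= -mulrA -invfM -expr2; congr (_ / _).
by rewrite /pairs big_allpairs_dep.
Qed.

End HaarIntegral.

(** * Moduli, convergence, and real and imaginary parts *)

Section ComplexAnalysis.
Variable R : realType.

Lemma cabs_expi (x y : R) : cabs (expi x y) = expR x.
Proof.
rewrite /cabs /expi/= !exprMn -mulrDr cos2Dsin2 mulr1 sqrtr_sqr ger0_norm//.
Qed.

Lemma cpow_neq1 (a : R) (z : R[i]) : 1 < a -> complex.Re z < 0 -> 1 - cpow a z != 0.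
Proof.
move=> a1 z0; rewrite subr_eq0; apply/negP => /eqP /(congr1 (@cabs R)).
rewrite cpowE cabs_expi /cabs/= expr1n expr0n/= addr0 sqrtr1 => h.
have : expR (complex.Re z * ln a) < 1.
  by rewrite -expR0 ltr_expR pmulr_llt0// ln_gt0.
by rewrite -h ltxx.
Qed.

Lemma cabs_le (z : R[i]) : cabs z <= `|complex.Re z| + `|complex.Im z|.
Proof.
have h : 0 <= `|complex.Re z| + `|complex.Im z| by rewrite addr_ge0.
rewrite -[leRHS](ger0_norm h) -sqrtr_sqr ler_sqrt ?sqr_ge0//.
rewrite sqrrD !real_normK ?num_real// -addrA [_ *+ 2 + _]addrC addrA lerDl.
by rewrite mulrn_wge0// mulr_ge0.
Qed.

Lemma cvg_complex_geometric (u : nat -> R[i]^o) (l : R[i]^o) (B tau : R) :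
  0 <= tau < 1 ->
  (forall n, `|complex.Re (l - u n)| <= B * tau ^+ n) ->
  (forall n, `|complex.Im (l - u n)| <= B * tau ^+ n) ->
  u n @[n --> \oo] --> l.
Proof.
move=> /andP[tau0 tau1] hRe hIm; apply/cvgrPdist_lt => e e0.
have eE : e = (complex.Re e)%:C.
  by case: e e0 => a b; rewrite ltcE/= => /andP[/eqP-> _].
have e0' : 0 < complex.Re e by move: e0; rewrite {1}eE ltcR.
have : (B + B) * tau ^+ n @[n --> \oo] --> (B + B) * (0 : R).
  by apply: cvgMl_tmp; apply: cvg_expr; rewrite ger0_norm.
rewrite mulr0 => /cvgrPdist_lt /(_ _ e0'); apply: filterS => n.
rewrite sub0r normrN => h; rewrite cabsE eE ltcR.
apply: le_lt_trans (cabs_le _) _; apply: le_lt_trans h.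
by apply: le_trans (lerD (hRe n) (hIm n)) _; rewrite -mulrDl ler_norm.
Qed.

Lemma Re_divn (z : R[i]) (n : nat) : complex.Re (z / n%:R) = complex.Re z / n%:R.
Proof.
rewrite -(rmorph_nat (real_complex R)) -fmorphV /=; case: z => a b /=; simpc.
by rewrite ?mulr0 ?subr0.
Qed.

Lemma Im_divn (z : R[i]) (n : nat) : complex.Im (z / n%:R) = complex.Im z / n%:R.
Proof.
rewrite -(rmorph_nat (real_complex R)) -fmorphV /=; case: z => a b /=; simpc.
by rewrite ?mulr0 ?add0r.
Qed.

(** Meant for real and imaginary parts: a mean involves only sums and divisions by natural
    numbers. *)
Lemma mean2_linear (K : localFieldType) (pi : K) (h : {additive R[i] -> R}) M
    (f : K -> K -> R[i]) : is_uniformizer pi ->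
  (forall z n, h (z / n%:R) = h z / n%:R) -> per2 M f ->
  h (mean2 pi f) = mean2 pi (fun u v => h (f u v)).
Proof.
move=> pi_unif hn fM.
have hfM : per2 M (fun u v => h (f u v)) by move=> *; rewrite fM.
rewrite (mean2E pi_unif fM (leqnn M)) (mean2E pi_unif hfM (leqnn M)) /avg.
rewrite hn raddf_sum; congr (_ / _); apply: eq_bigr => x _.
by rewrite hn raddf_sum.
Qed.

End ComplexAnalysis.

(** * The zeta integral as the sum of a power series in $q^(-s)$ *)

Section ZetaSeries.
Variables (R : realType) (K : localFieldType) (pi : K).
Hypothesis pi_unif : is_uniformizer pi.
Variable mu : {measure set (borel K 2) -> \bar R}.
Hypothesis mu_haar : is_normalized_haar mu.
Variables (chi : K -> R[i]) (c : nat).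
Hypothesis c_gt0 : (0 < c)%N.
Hypothesis chi_c : forall x z, x != 0 -> valz x = 0 -> dv c z -> chi (x + z) = chi x.
Local Notation q := (residue_card K).
Local Notation O2 := (@integers_pow K 2 : set (borel K 2)).
Local Notation phi := (phi pi chi).

(** On units [chi] takes only its values at residues modulo $pi^c$; the sum over all of them bounds
    each one. *)
Lemma chi_bounded : exists B : R, 0 <= B /\
  forall x, x != 0 -> valz x = 0 -> `|complex.Re (chi x)| + `|complex.Im (chi x)| <= B.
Proof.
exists (\sum_(a <- reps pi c) (`|complex.Re (chi a)| + `|complex.Im (chi a)|)).
split=> [|x x0 vx]; first by apply: sumr_ge0 => a _; rewrite addr_ge0.
have [|a aR xa] := reps_ex pi_unif c (x := x); first by rewrite dvN0// vx.
have -> : chi x = chi a.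
  by rewrite -[in RHS](subrK x a) addrC chi_c// dvC.
rewrite (bigD1_seq a) ?reps_uniq//= lerDl.
by apply: sumr_ge0 => b _; rewrite addr_ge0.
Qed.

Variable s : R[i].
Hypothesis s_gt0 : 0 < complex.Re s.
Let t : R[i] := cpow q%:R (- s).
(** The modulus of [t]. *)
Let tau : R := expR (- complex.Re s * ln q%:R).

Let q1 : 1 < q%:R :> R. Proof. by rewrite ltr1n q_gt1. Qed.
Let q0 : 0 < q%:R :> R. Proof. exact: lt_trans q1. Qed.

Lemma tau_bounds : 0 <= tau < 1.
Proof.
by rewrite /tau expR_ge0/= -[ltRHS]expR0 ltr_expR mulNr oppr_lt0 mulr_gt0 ?ln_gt0.
Qed.

Definition integrand (w : K) : R[i] := chi_ac chi pi w * cpow (absK R w) s.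

Lemma integrand_sphere w (n : nat) : w != 0 -> valz w = n -> integrand w = phi n w * t ^+ n.
Proof.
move=> w0 wn; rewrite /integrand /chi_ac /absK /ac /phi (negbTE w0) /= wn eqxx.
rewrite -/(valz w) wn exprnN; congr (_ * _).
by rewrite cpowV_nat.
Qed.

Lemma phi_sphere w (i n : nat) : w != 0 -> valz w = n -> i != n -> phi i w = 0.
Proof.
move=> w0 wn; rewrite eq_sym => ni; rewrite /phi w0 wn/= ifF//.
by apply/negbTE; rewrite eqz_nat.
Qed.

(** Only the term with [n] equal to the valuation of [w] can be nonzero, and it equals the
    integrand. The error is thus 0, or the integrand itself at a level at least [N]. *)
Lemma integrand_error (B : R) :
  (forall x, x != 0 -> valz x = 0 -> `|complex.Re (chi x)| + `|complex.Im (chi x)| <= B) ->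
  0 <= B -> forall w N, dv 0 w ->
  `|complex.Re (integrand w - \sum_(n < N) phi n w * t ^+ n)| <= B * tau ^+ N /\
  `|complex.Im (integrand w - \sum_(n < N) phi n w * t ^+ n)| <= B * tau ^+ N.
Proof.
move=> chiB B0 w N w0; have /andP[tau0 tau1] := tau_bounds.
have bnd0 : 0 <= B * tau ^+ N by rewrite mulr_ge0// exprn_ge0.
have [wz|wn0] := eqVneq w 0.
  rewrite wz /integrand /chi_ac eqxx mul0r big1 ?subr0 ?normr0//.
  by move=> i _; rewrite /phi eqxx mul0r.
have [n wn] : exists n : nat, valz w = n.
  by exists `|valz w|%N; rewrite gez0_abs//; move: w0; rewrite dvN0.
rewrite (integrand_sphere wn0 wn).
have [nN|Nn] := ltnP n N.
  rewrite (bigD1 (Ordinal nN))//= big1 ?addr0 ?subrr ?normr0//.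
  by move=> i ni; rewrite (phi_sphere wn0 wn) ?mul0r.
rewrite big1 ?subr0; last first.
  by move=> i _; rewrite (phi_sphere wn0 wn) ?mul0r// neq_ltn (leq_trans (ltn_ord i)).
rewrite /phi wn0 wn eqxx /=; set x := w / pi ^+ n.
have piN := piX_neq0 pi_unif n.
have x0 : x != 0 by rewrite mulf_neq0// invr_eq0.
have xv : valz x = 0.
  by rewrite valzM ?invr_eq0// valzV// wn (valz_piX pi_unif) subrr.
have := chiB x x0 xv; case: (chi x) => a b /= ab.
have tauN : tau ^+ n <= tau ^+ N by rewrite ler_wiXn2l// ltW.
have tE : exists y, t ^+ n = (tau ^+ n * cos y) +i* (tau ^+ n * sin y).
  exists ((complex.Im (- s) * ln q%:R) *+ n).
  by rewrite /t cpowE expiX /expi /tau -expRM_natl mulr_natl; case: (s).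
have [y ->] := tE; set T := tau ^+ n in tauN *; rewrite /=.
have T0 : 0 <= T by rewrite exprn_ge0.
have cos1 : `|cos y| <= 1 by rewrite ler_norml cos_geN1 cos_le1.
have sin1 : `|sin y| <= 1 by rewrite ler_norml sin_geN1 sin_le1.
(* One estimate covers both the real and the imaginary part of the product, up to signs and the
   order of sine and cosine. *)
have main d e (C S : R) : `|d| + `|e| <= B -> `|C| <= 1 -> `|S| <= 1 ->
    `|d * (T * C) + e * (T * S)| <= B * tau ^+ N.
  move=> de C1 S1; apply: (@le_trans _ _ (B * T)); last by rewrite ler_wpM2l.
  apply: le_trans (ler_normD _ _) _; rewrite !normrM (ger0_norm T0).
  apply: (@le_trans _ _ ((`|d| + `|e|) * T)); last by rewrite ler_wpM2r.
  by rewrite mulrDl lerD// ler_wpM2l// ler_piMr.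
split; last exact: main.
rewrite -mulrN -mulrN; apply: main => //.
by rewrite normrN.
Qed.

Variable g : K -> K -> K.
Hypothesis g_int : forall u v, dv 0 u -> dv 0 v -> dv 0 (g u v).
Hypothesis g_per : forall n, per2 (n + c) (fun u v => phi n (g u v)).

Let C n : R[i] := mean2 pi (fun u v => phi n (g u v)).
Let FN N u v : R[i] := \sum_(n < N) phi n (g u v) * t ^+ n.

Lemma per2_FN N : per2 (N + c) (FN N).
Proof.
move=> u v z z' u0 v0 zz zz'; apply: eq_bigr => i _; congr (_ * _).
by apply: g_per => //; [apply: dvW zz|apply: dvW zz']; rewrite lez_nat leq_add2r ltnW.
Qed.

Lemma partial_series_mean2 N : partial_series C t N = mean2 pi (FN N).
Proof.
elim: N => [|N IH].
  rewrite /partial_series big_ord0 /FN; apply: esym; apply: mean0 => // u u0.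
  by apply: mean0 => // v v0; rewrite big_ord0.
rewrite /partial_series big_ord_recr/= -/(partial_series C t N) IH /C mulrC.
have p1 : per2 (N.+1 + c) (FN N).
  move=> u v z z' u0 v0 zz zz'; apply: per2_FN => //; [apply: dvW zz|apply: dvW zz']; lia.
have p2 : per2 (N.+1 + c) (fun u v => t ^+ N * phi N (g u v)).
  move=> u v z z' u0 v0 zz zz'; congr (_ * _).
  by apply: g_per => //; [apply: dvW zz|apply: dvW zz']; lia.
rewrite -(mean2Z pi_unif _ (@g_per N)) -(mean2D pi_unif p1 p2).
congr mean2; apply/funext => u; apply/funext => v.
by rewrite /FN big_ord_recr/= [t ^+ N * _]mulrC.
Qed.

(** The integrand is a uniform limit of locally constant functions, which gives its measurability;
    as $O_K^2$ has measure 1, integrals differ by at most the uniform error. *)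
Lemma part_error (h : {additive R[i] -> R}) (B : R) :
  (forall z n, h (z / n%:R) = h z / n%:R) ->
  (forall w N, dv 0 w ->
    `|h (integrand w - \sum_(n < N) phi n w * t ^+ n)| <= B * tau ^+ N) ->
  forall N, `|\int[mu]_(x in O2) h (integrand (g ((x : 'rV[K]_2) ord0 0) ((x : 'rV[K]_2) ord0 1)))
     - h (partial_series C t N)| <= B * tau ^+ N.
Proof.
move=> hn hB N; have /andP[tau0 tau1] := tau_bounds.
pose f (x : borel K 2) := h (integrand (g ((x : 'rV[K]_2) ord0 0) ((x : 'rV[K]_2) ord0 1))).
pose fN k (x : borel K 2) := h (FN k ((x : 'rV[K]_2) ord0 0) ((x : 'rV[K]_2) ord0 1)).
have perh k : per2 (k + c) (fun u v => h (FN k u v)).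
  by move=> u v z z' u0 v0 zz zz'; rewrite (per2_FN u0 v0 zz zz').
have mfN k : measurable_fun O2 (fN k) := (haar_mean_real pi_unif mu_haar (perh k)).1.
have ifN k : \int[mu]_(x in O2) fN k x = h (partial_series C t k).
  rewrite partial_series_mean2 (mean2_linear pi_unif hn (@per2_FN k)).
  exact: (haar_mean_real pi_unif mu_haar (perh k)).2.
have xO (x : 'rV[K]_2) : O2 x -> dv 0 (g (x ord0 0) (x ord0 1)).
  by move=> xO2; apply: g_int; rewrite -integersE; exact: xO2.
have err k x : O2 x -> `|f x - fN k x| <= B * tau ^+ k.
  by move=> /xO /(hB _ k); rewrite raddfB.
have cvg0 : B * tau ^+ k @[k --> \oo] --> (0 : R).
  by rewrite -(mulr0 B); apply: cvgMl_tmp; apply: cvg_expr; rewrite ger0_norm.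
have mf : measurable_fun O2 f.
  apply: (measurable_fun_cvg mfN) => x xO2; apply/cvgrPdist_lt => e e0.
  move/cvgrPdist_lt: cvg0 => /(_ _ e0); apply: filterS => k.
  rewrite sub0r normrN => h1; apply: le_lt_trans (err k x xO2) _.
  exact: le_lt_trans (ler_norm _) h1.
have If : mu.-integrable O2 (EFin \o f).
  apply: (integrable_bounded mu_haar (B := B)) => // x /xO /(hB _ 0%N).
  by rewrite big_ord0 subr0 expr0 mulr1.
have IfN k : mu.-integrable O2 (EFin \o fN k).
  apply: (integrable_bounded mu_haar (B := B + B)) => // x xO2.
  have h1 := err k x xO2; have := hB _ 0%N (xO x xO2).
  rewrite big_ord0 subr0 expr0 mulr1 -/(f x) => h2.
  rewrite -(subKr (f x) (fN k x)); apply: le_trans (ler_normB _ _) _; rewrite lerD//.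
  apply: le_trans h1 _; rewrite ler_piMr ?exprn_ile1 ?(ltW tau1)//.
  exact: le_trans h2.
have mO : measurable O2 by exact: measurable_O2.
rewrite -ifN -(RintegralB mO If (IfN N)).
have Id : mu.-integrable O2 (EFin \o (fun x => f x - fN N x)).
  apply: (integrable_bounded mu_haar (B := B * tau ^+ N)); last exact: err.
  exact: measurable_funB.
apply: le_trans (le_normr_Rintegral _ Id) _ => //.
have -> : B * tau ^+ N = \int[mu]_(x in O2) (B * tau ^+ N).
  by rewrite Rintegral_cst// [X in fine X](mu_O2 mu_haar) mulr1.
apply: le_Rintegral => //; [exact: integrable_norm| |by move=> x; exact: err].
by apply: (integrable_bounded mu_haar (B := `|B * tau ^+ N|)) => //; exact: measurable_cst.
Qed.

Lemma zeta_series_cvg :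
  (partial_series C t n : R[i]^o) @[n --> \oo] -->
  (Cintegral mu O2 (fun x : 'rV[K]_2 => integrand (g (x ord0 0) (x ord0 1))) : R[i]^o).
Proof.
have [B [B0 chiB]] := chi_bounded.
have err := integrand_error chiB B0.
apply: (cvg_complex_geometric tau_bounds (B := B)) => n; rewrite raddfB /=.
- apply: (part_error (h := @complex.Re R)) => [z k|w N w0]; first exact: Re_divn.
  by have [] := err w N w0.
- apply: (part_error (h := @complex.Im R)) => [z k|w N w0]; first exact: Im_divn.
  by have [] := err w N w0.
Qed.

End ZetaSeries.

(** * The polynomial $g$ and the assembly of the proof *)

Lemma admissible_of_ord (K : localFieldType) (i0 N : nat) (alpha : nat -> K) :
  (0 < i0)%N -> (i0 <= N)%N -> integers (alpha i0) -> alpha i0 != 0 ->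
  (forall i, (i0.+1 <= i <= N)%N -> (ord (alpha i0) < ord (alpha i))%E) ->
  exists e, admissible e i0 N alpha.
Proof.
move=> i0_gt0 i0_le_N; rewrite integersE => a_int a_neq0 a_ord.
have e0 : 0 <= valz (alpha i0) by move: a_int; rewrite dvN0.
exists `|valz (alpha i0)|%N; split; rewrite ?i0_gt0 ?gez0_abs// => i /a_ord.
rewrite /dv ordE//; have [//|ai] := eqVneq (alpha i) 0.
by rewrite ordE// lte_fin lezD1.
Qed.

Lemma meval_separated (K : localFieldType) (i0 N j0 M : nat) (alpha beta : nat -> K)
    (x : 'I_2 -> K) :
  mpoly.meval x (separated_poly i0 N j0 M alpha beta) =
  psum i0 N alpha (x 0) + psum j0 M beta (x 1).
Proof.
rewrite /separated_poly mpoly.mevalD !raddf_sum /psum; congr (_ + _);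
  by apply: eq_bigr => i _; rewrite /= mpoly.mevalZ rmorphXn /= mpoly.mevalXU.
Qed.

Theorem theorem1p1 (R : realType) (K : localFieldType)
  (p : nat) (charK : p \in [pchar K])
  (pi : K) (pi_unif : is_uniformizer pi)
  (mu : {measure set (borel K 2) -> \bar R}) (mu_haar : is_normalized_haar mu)
  (chi : K -> R[i]) (chi_char : is_character chi)
  (i0 N j0 M : nat) (alpha beta : nat -> K)
  (i0_gt0 : (0 < i0)%N) (j0_gt0 : (0 < j0)%N)
  (i0_le_N : (i0 <= N)%N) (j0_le_M : (j0 <= M)%N)
  (i0j0_coprime : coprime i0 j0)
  (alpha_int : forall i, (i0 <= i <= N)%N -> integers (alpha i))
  (beta_int : forall j, (j0 <= j <= M)%N -> integers (beta j))
  (alphabeta_neq0 : alpha i0 * beta j0 != 0)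
  (alpha_ord : forall i, (i0.+1 <= i <= N)%N -> (ord (alpha i0) < ord (alpha i))%E)
  (beta_ord : forall j, (j0.+1 <= j <= M)%N -> (ord (beta j0) < ord (beta j))%E) :
  let q : R := (residue_card K)%:R in
  exists G : {poly R[i]}, forall s : R[i], 0 < complex.Re s ->
    igusa_zeta pi mu chi (separated_poly i0 N j0 M alpha beta) s =
    G.[cpow q (- s)] /
      ((1 - cpow q (- 1 - s)) *
       (1 - cpow q (- i0%:R - j0%:R - (i0 * j0)%:R * s))).
Proof.
move=> q.
have [a0 b0] : alpha i0 != 0 /\ beta j0 != 0.
  by apply/andP; move: alphabeta_neq0; rewrite mulf_eq0 negb_or.
have [eA admA] : exists e, admissible e i0 N alpha.
  by apply: admissible_of_ord => //; apply: alpha_int; rewrite leqnn.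
have [eB admB] : exists e, admissible e j0 M beta.
  by apply: admissible_of_ord => //; apply: beta_int; rewrite leqnn.
(* By coprimality [p] cannot divide both exponents. *)
have unit_exp : (i0%:R != 0 :> K /\ valz (i0%:R : K) = 0) \/
                (j0%:R != 0 :> K /\ valz (j0%:R : K) = 0).
  have [pi0|pi0] := boolP (p %| i0)%N; last by left; exact: (valz_natr charK).
  right; apply: (valz_natr charK); apply/negP => pj0.
  have : (p %| gcdn i0 j0)%N by rewrite dvdn_gcd pi0.
  by rewrite (eqP i0j0_coprime) dvdn1 => /eqP p1; have := pcharf_prime charK; rewrite p1.
have [c [c_gt0 chi_c]] := conductor chi_char.
pose Z := zcoef pi chi i0 N alpha j0 M beta.
pose r : R[i] := (residue_card K)%:R^-1.
pose rho : R[i] := (residue_card K ^ (i0 + j0))%:R^-1.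
have Zrec : eventually_rec r rho (i0 * j0) (Z 0%N).
  apply: (eventually_rec_iter (d := dcoef pi chi i0 N alpha j0 M beta)
    (n1 := (threshold eA i0 eB j0 + threshold eB j0 eA i0)%N)
    (k0 := (threshold eA i0 eB j0 + threshold eB j0 eA i0 + c)%N)).
  - by rewrite muln_gt0 i0_gt0.
  - by move=> k n; exact: (zcoef_rec pi_unif c_gt0 chi_c admA admB).
  - by move=> k n; exact: (dcoefS pi_unif c_gt0 chi_c admA admB).
  - by move=> k n; exact: (dcoef_stable pi_unif c_gt0 chi_c admA admB).
have [G GP] := rational_series Zrec.
exists G => s s_gt0.
have q_gt1 : 1 < q by rewrite ltr1n; exact: q_gt1.
have q_gt0 : 0 < q by exact: lt_trans q_gt1.
have qC : q%:C = (residue_card K)%:R by rewrite /q rmorph_nat.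
have den1 : 1 - cpow q (- 1 - s) != 0.
  apply: cpow_neq1 => //; case: s s_gt0 => x y /=; lra.
have den2 : 1 - cpow q (- i0%:R - j0%:R - (i0 * j0)%:R * s) != 0.
  apply: cpow_neq1 => //; rewrite -!(rmorph_nat (real_complex R)).
  case: s s_gt0 {den1} => x y /= x0.
  have := mulr_ge0 (ler0n R (i0 * j0)) (ltW x0).
  have : 0 < i0%:R :> R by rewrite ltr0n.
  have : 0 <= j0%:R :> R by [].
  lra.
have cp1 : cpow q (- 1 - s) = r * cpow q (- s).
  have := cpow_nat 1 1 s q_gt0; rewrite mul1r expr1 qC => ->.
  by rewrite expr1.
have cp2 : cpow q (- i0%:R - j0%:R - (i0 * j0)%:R * s) = rho * cpow q (- s) ^+ (i0 * j0).
  rewrite -opprD -natrD cpow_nat// qC /rho natrX.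
  by [].
(* With denominators cleared this is the identity of [rational_series] at $t = q^(-s)$; the
   convergence of the series to the integral remains. *)
apply: (canRL (mulfK (mulf_neq0 den1 den2))); rewrite mulrC cp1 cp2.
apply: GP.
pose g u v := psum i0 N alpha u + psum j0 M beta v.
have g_int u v : dv 0 u -> dv 0 v -> dv 0 (g u v).
  by move=> u0 v0; apply: dvD; [exact: (psum_int admA)|exact: (psum_int admB)].
have g_per n := per2_phi pi_unif c_gt0 chi_c admA admB (n := n).
have := zeta_series_cvg pi_unif mu_haar c_gt0 chi_c s_gt0 g_int g_per.
(* At [k = 0] the rescaling is by [pi ^+ 0], so $g_0$ is $g$. *)
have -> : (fun n => mean2 pi (fun u v => phi pi chi n (g u v))) = Z 0%N.
  apply/funext => n; rewrite /Z /zcoef /Asc /Bsc /g.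
  have r0 k f : rescale pi 0 k f = f by apply/funext => i; rewrite /rescale expr0 mulr1.
  by rewrite !mul0n !r0.
rewrite /igusa_zeta (_ : (fun x : 'rV[K]_2 => _) =
  (fun x : 'rV[K]_2 => integrand pi chi s (g (x ord0 0) (x ord0 1))))//.
by apply/funext => x; rewrite meval_separated.
Qed.
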